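(* Let $\mathcal S$ be a family of bridgeless connected graphs and $\beta\in(1,2]$. Assume there exists $\mathcal S'\subseteq\mathcal S$ such that: (i) $Q(G,\lambda)>0$ for all $G\in\mathcal S'$ and all $\lambda\in(1,\beta)$; (ii) for every separable $G\in\mathcal S$, all blocks of $G$ belong to $\mathcal S$; (iii) for every non-separable $G\in\mathcal S\setminus\mathcal S'$, at least one of the following holds: (a) there is an edge $e=u_1u_2$ of $G$ such that $G-e$ has a cut-vertex $v$, and edge-disjoint subgraphs $H_1,H_2$ with $E(H_1)\cup E(H_2)=E(G-e)$, $V(H_1)\cap V(H_2)=\{v\}$, $V(H_1)\cup V(H_2)=V(G)$, $u_1\in V(H_1)$, $u_2\in V(H_2)$, such that $G_1=H_1+vu_1$ and $G_2=H_2+vu_2$ both belong to $\mathcal S$; (b) there is an edge $e$ of $G$ such that $G-e,G/e\in\mathcal S$ and both $b(G-e)$ and $b(G/e)$ are odd; (c) there are subgraphs $G_1,G_2$ of $G$ with $V(G_1)\cap V(G_2)=\{u_1,u_2\}$, $V(G_1)\cup V(G_2)=V(G)$, $E(G_1)\cap E(G_2)=\emptyset$, $E(G_1)\cup E(G_2)=E(G)$, such that $b(G_1)+b(G_2)$ is even and, for $i=1,2$, $|E(G_i)|\ge 2$ and both $G_i$ and $G_i+u_1u_2$ belong to $\mathcal S$; (d) there are subgraphs $G_1,G_2$ of $G$ with $|E(G_1)|\ge 3$, $|E(G_2)|\ge 2$, $V(G_1)\cap V(G_2)=\{u_1,u_2\}$, $V(G_1)\cup V(G_2)=V(G)$, $E(G_1)\cap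 E(G_2)=\emptyset$, $E(G_1)\cup E(G_2)=E(G)$, such that $b(G_1/u_1u_2)+b(G_2)$ is odd and $G_1+u_1u_2$, $G_1/u_1u_2$, $G_2$, $G_2+u_1u_2$, $G_2+2u_1u_2$ all belong to $\mathcal S$. Then $Q(G,\lambda)>0$ for all $G\in\mathcal S$ and all real $\lambda\in(1,\beta)$.
   Context: Graphs are finite, undirected, possibly with loops and parallel edges. The flow polynomial $F(G,\lambda)$ is determined by: $F(G,\lambda)=1$ if $E(G)=\emptyset$; $F(G,\lambda)=0$ if $G$ has a bridge; multiplicative over disjoint unions; $F(G,\lambda)=(\lambda-1)F(G-e,\lambda)$ if $e$ is a loop; otherwise $F(G,\lambda)=F(G/e,\lambda)-F(G-e,\lambda)$ ($G/e$ = contraction of $e$). A graph is non-separable if it is connected, has no cut-vertex, and either has no loops or has exactly one vertex and one edge; otherwise it is separable. A block is a maximal non-separable subgraph; $b(G)$ is the number of blocks of $G$ having at least one edge. For vertices $u_1,u_2$: $G/u_1u_2$ is obtained by identifying $u_1$ and $u_2$ (edges between them become loops); $G+u_1u_2$ by adding a new edge joining them; $G+2u_1u_2$ by adding two new parallel edges joining them. For a connected graph $G$, $p(G)=|E(G)|-|V(G)|+b(G)-1$ and $Q(G,\lambda)=(-1)^{p(G)}F(G,\lambda)$. *)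

(* Defs.v *)
From HB Require Import structures.
From mathcomp Require Import all_boot all_order all_algebra.
From mathcomp Require Import finmap.
From mathcomp Require Import boolp reals.
From Stdlib Require Import Relations.Relation_Operators.
Set Implicit Arguments. Unset Strict Implicit. Unset Printing Implicit Defensive.
Import Order.TTheory GRing.Theory Num.Theory.
Local Open Scope fset_scope.

(* A (multi)graph: a finite vertex set, a finite edge set, and an end-point
   function (only its values on edges matter; the order of the two ends is
   irrelevant: edges are undirected).  Loops: both ends equal.  Parallel
   edges: distinct labels with the same ends. *)
Record graph := Graph { gV : {fset nat}; gE : {fset nat}; gends : nat -> nat * nat }.

Definition wf (G : graph) : Prop :=
  forall e, e \in gE G -> ((gends G e).1 \in gV G) /\ ((gends G e).2 \in gV G).

Definition is_loop (G : graph) (e : nat) : bool := (gends G e).1 == (gends G e).2.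

Definition adj (ends : nat -> nat * nat) (A : {fset nat}) (x y : nat) : Prop :=
  exists2 e, e \in A & (ends e = (x, y) \/ ends e = (y, x)).
Definition conn ends A := clos_refl_trans nat (adj ends A).

(* number of connected components of the graph (V, A) (with given ends):
   the number of vertices that are the least vertex of their component *)
Definition ncomp (ends : nat -> nat * nat) (V A : {fset nat}) : nat :=
  #|` [fset x in V | `[< forall y, y \in V -> conn ends A x y -> (x <= y)%N >]] |.

Definition comps (G : graph) : nat := ncomp (gends G) (gV G) (gE G).

Definition connected (G : graph) : Prop :=
  wf G /\ gV G != fset0 /\
  forall x y, x \in gV G -> y \in gV G -> conn (gends G) (gE G) x y.

Definition del_edge (G : graph) (e : nat) : graph :=
  Graph (gV G) (gE G `\ e) (gends G).

(* G/u1u2 : identify u2 with u1 (edges between them become loops) *)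
Definition ren (u1 u2 : nat) (x : nat) : nat := if x == u2 then u1 else x.
Definition identify (G : graph) (u1 u2 : nat) : graph :=
  Graph (if u1 == u2 then gV G else gV G `\ u2) (gE G)
        (fun f => (ren u1 u2 (gends G f).1, ren u1 u2 (gends G f).2)).

Definition contract (G : graph) (e : nat) : graph :=
  identify (del_edge G e) (gends G e).1 (gends G e).2.

Definition fresh (E : {fset nat}) : nat := (\max_(e <- E) e).+1.
Definition add_edge (G : graph) (u1 u2 : nat) : graph :=
  let f := fresh (gE G) in
  Graph (gV G) (f |` gE G) (fun x => if x == f then (u1, u2) else gends G x).

Definition add2_edge (G : graph) (u1 u2 : nat) : graph :=
  add_edge (add_edge G u1 u2) u1 u2.

Definition del_vertex (G : graph) (v : nat) : graph :=
  Graph (gV G `\ v)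
        [fset e in gE G | ((gends G e).1 != v) && ((gends G e).2 != v)]
        (gends G).

Definition subgraph (H G : graph) : Prop :=
  [/\ wf H, gV H `<=` gV G, gE H `<=` gE G & gends H = gends G].

Definition is_bridge (G : graph) (e : nat) : Prop :=
  e \in gE G /\ (comps G < comps (del_edge G e))%N.

Definition bridgeless (G : graph) : Prop := forall e, ~ is_bridge G e.

Definition is_cut_vertex (G : graph) (v : nat) : Prop :=
  v \in gV G /\ (comps G < comps (del_vertex G v))%N.

Definition nonseparable (G : graph) : Prop :=
  connected G /\ (forall v, ~ is_cut_vertex G v) /\
  ((forall e, e \in gE G -> ~~ is_loop G e) \/
   (#|` gV G| = 1%N /\ #|` gE G| = 1%N)).

Definition separable (G : graph) : Prop := connected G /\ ~ nonseparable G.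

Definition is_block (G B : graph) : Prop :=
  [/\ subgraph B G, nonseparable B &
      forall B', subgraph B' G -> nonseparable B' -> subgraph B B' -> B' = B].

Definition nblocks (G : graph) : nat :=
  #|` [fset p in fsetM (fpowerset (gV G)) (fpowerset (gE G)) |
        `[< p.2 != fset0 /\ is_block G (Graph p.1 p.2 (gends G)) >]] |.

(* --- flow polynomial (Tutte's subset expansion), evaluated at lambda ---
   F(G,l) = sum_{A subset E} (-1)^{|E|-|A|} l^{|A|-|V|+c(V,A)} *)
Definition flowpoly (R : realType) (G : graph) (l : R) : R :=
  \sum_(A <- fpowerset (gE G))
     (-1) ^+ (#|` gE G| - #|` A|) *
     l ^+ (#|` A| + ncomp (gends G) (gV G) A - #|` gV G|).

Definition pG (G : graph) : int :=
  (#|` gE G|%:Z - #|` gV G|%:Z + (nblocks G)%:Z - 1)%R.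

Definition Qpoly (R : realType) (G : graph) (l : R) : R :=
  ((-1) ^ pG G * flowpoly G l)%R.

(* Main.v *)
(* For a set A of edges of H and vertices u, v, let P_H(u,v) be the part of the
   subset expansion of F(H) carried by the sets A joining u to v. Comparing
   numbers of components gives
     F(H+uv) = (l-1) P_H(u,v),    F(H/uv) = F(H) + (l-1) P_H(u,v),
     F(H+2uv) = (l-1) (F(H) + (l-2) P_H(u,v)),
   and, if G is the edge-disjoint union of G1 and G2 meeting in {u,v},
     F(G) = F(G1) F(G2) + (l-1) P_G1(u,v) P_G2(u,v),
   while P is multiplicative across a cut vertex separating its arguments.
   Each of (a)-(d) thus expresses (l-1) F(G) through graphs of S with fewer
   edges, and the parities of the numbers of blocks make all the terms of the
   corresponding expression of (l-1) Q(G) positive. Separable graphs reduce to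
   their blocks because Q is multiplicative across a cut vertex. *)
Require Import Defs.
From HB Require Import structures.
From mathcomp Require Import all_boot all_order all_algebra.
From mathcomp Require Import finmap.
From mathcomp Require Import boolp reals.
From mathcomp Require Import zify ring.
From Stdlib Require Import Relations.Relation_Operators.
Set Implicit Arguments. Unset Strict Implicit. Unset Printing Implicit Defensive.
Import Order.TTheory GRing.Theory Num.Theory.
Local Open Scope fset_scope.

(** * Connectivity and components *)

(** [P_H(u,v)] is not the flow polynomial of a graph of the family, but (l-1) P_H(u,v) is. Hence
    (a), (c) and (d) are exploited only after multiplying by the positive number l - 1.

    All comparisons of component counts come from inserting edges one at a time: two counts are
    followed along the insertion, and the exchange property of the graphic matroid tells when they
    drop differently.

    The delicate point is the sign. Membership in the family says only that a graph such as G1 +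
    u1u2 is connected, while the sign of Q depends on the parity of its number of blocks.
    Nonseparability of [G] is therefore transferred to each graph obtained from a side by adding
    edges: a path of [G] avoiding a vertex can be rerouted through the added edge. Those graphs have
    exactly one block, and the other parities are the ones assumed in (b), (c) and (d).

    The induction is on the number of edges alone, so each auxiliary graph, added edges included,
    must have fewer edges than [G]. *)

Definition is_equiv (r : nat -> nat -> Prop) : Prop :=
  [/\ forall x, r x x, forall x y, r x y -> r y x &
      forall x y z, r x y -> r y z -> r x z].

(** For an equivalence [r], this is the equivalence generated by [r] and the pair (a, b): a path
    needs the new link at most once, in one of its two directions. *)
Definition fuse (r : nat -> nat -> Prop) (a b x y : nat) : Prop :=
  [\/ r x y, r x a /\ r b y | r x b /\ r a y].

Lemma fuse_equiv r a b : is_equiv r -> is_equiv (fuse r a b).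
Proof.
move=> [rr rs rt]; split=> [x|x y|x y z]; first by constructor 1.
  by move=> [xy|[xa yb]|[xb ay]];
    [constructor 1|constructor 3|constructor 2]; try split; apply: rs.
move=> [xy|[xa yb]|[xb ay]] [yz|[ya bz]|[yb' az]].
- by constructor 1; apply: rt yz.
- by constructor 2; split=> //; apply: rt ya.
- by constructor 3; split=> //; apply: rt yb'.
- by constructor 2; split=> //; apply: rt yz.
- by constructor 2.
- by constructor 1; apply: rt az.
- by constructor 3; split=> //; apply: rt yz.
- by constructor 1; apply: rt bz.
- by constructor 3.
Qed.

Lemma fuseC r a b x y : fuse r a b x y <-> fuse r b a x y.
Proof.
by split=> -[]; [constructor 1|constructor 3|constructor 2
                |constructor 1|constructor 3|constructor 2].
Qed.

Lemma fuse_id r a x y : is_equiv r -> fuse r a a x y <-> r x y.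
Proof.
move=> [_ _ rt]; split; last by constructor 1.
by move=> [//|[xa ay]|[xa ay]]; apply: rt ay.
Qed.

Lemma fuse_rel r a b x y : is_equiv r -> r a b -> fuse r a b x y <-> r x y.
Proof.
move=> [_ rs rt] ab; split; last by constructor 1.
by move=> [//|[xa bz]|[xb az]]; [exact: rt (rt _ _ _ xa ab) bz
  |exact: rt (rt _ _ _ xb (rs _ _ ab)) az].
Qed.

Lemma fuse_pair r a b : is_equiv r -> fuse r a b a b.
Proof. by move=> [rr _ _]; constructor 2. Qed.

(** Exchange property of the graphic matroid, for the two potential edges ab and xy. *)
Lemma fuse_exchange r a b x y : is_equiv r -> ~ r a b -> ~ r x y ->
  fuse r a b x y -> fuse r x y a b.
Proof.
move=> [_ rs rt] nab nxy [//|[xa bz]|[xb az]].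
  by constructor 2; split; apply: rs.
by constructor 3.
Qed.

Lemma conn_equiv ends A : is_equiv (conn ends A).
Proof.
split=> [x|x y|x y z]; first exact: rt_refl.
  elim=> [u v [e eA h]|u|u v w _ IH1 _ IH2].
  - by apply: rt_step; exists e => //; case: h; [right|left].
  - exact: rt_refl.
  - exact: rt_trans IH2 IH1.
exact: rt_trans.
Qed.

Lemma conn_refl ends A x : conn ends A x x. Proof. exact: rt_refl. Qed.

Lemma conn_sym ends A x y : conn ends A x y -> conn ends A y x.
Proof. by case: (conn_equiv ends A) => _ s _; apply: s. Qed.

Lemma conn_trans ends A x y z :
  conn ends A x y -> conn ends A y z -> conn ends A x z.
Proof. exact: rt_trans. Qed.

Lemma conn_edge ends A e : e \in A -> conn ends A (ends e).1 (ends e).2.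
Proof. by move=> eA; apply: rt_step; exists e => //; left; case: (ends e). Qed.

(** Connectivity is the least equivalence containing the edges, so it suffices to check a vertex map
    edge by edge. Renamings and retractions onto one side of a gluing are handled this way. *)
Lemma conn_map {ends A} (r : nat -> nat -> Prop) (phi : nat -> nat) :
  is_equiv r ->
  (forall e, e \in A -> r (phi (ends e).1) (phi (ends e).2)) ->
  forall x y, conn ends A x y -> r (phi x) (phi y).
Proof.
move=> [rr rs rt] re x y; elim=> [u v [e eA h]|u|u v w _ IH1 _ IH2].
- by have := re e eA; case: h => -> //=; apply: rs.
- exact: rr.
- exact: rt IH1 IH2.
Qed.

Lemma conn_min {ends A} (r : nat -> nat -> Prop) :
  is_equiv r -> (forall e, e \in A -> r (ends e).1 (ends e).2) ->
  forall x y, conn ends A x y -> r x y.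
Proof. exact: conn_map id. Qed.

Lemma conn_mono ends (A B : {fset nat}) x y :
  A `<=` B -> conn ends A x y -> conn ends B x y.
Proof.
move=> /fsubsetP AB; apply: conn_min (conn_equiv _ _) _ _ _ => e /AB.
exact: conn_edge.
Qed.

Lemma conn_ext ends ends' (A : {fset nat}) x y :
  {in A, ends =1 ends'} -> conn ends A x y <-> conn ends' A x y.
Proof.
move=> eq; split; apply: conn_min (conn_equiv _ _) _ _ _ => e eA.
  by rewrite eq //; apply: conn_edge.
by rewrite -eq //; apply: conn_edge.
Qed.

Lemma conn_closed ends A (P : nat -> Prop) x y :
  (forall e, e \in A -> P (ends e).1 <-> P (ends e).2) ->
  conn ends A x y -> P x -> P y.
Proof.
move=> h xy; suff [] : P x <-> P y by [].
apply: (conn_min (r := fun x y => P x <-> P y) _ h xy).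
by split=> //; intuition.
Qed.

Lemma conn_add ends A e x y :
  conn ends (e |` A) x y <->
  fuse (conn ends A) (ends e).1 (ends e).2 x y.
Proof.
split.
  apply: conn_min; first exact/fuse_equiv/conn_equiv.
  move=> f /fset1UP[->|fA]; first exact/fuse_pair/conn_equiv.
  by constructor 1; apply: conn_edge.
have sA x' y' := @conn_mono ends _ _ x' y' (fsubsetU1 e A).
have ee : conn ends (e |` A) (ends e).1 (ends e).2.
  by apply: conn_edge; apply: fset1U1.
move=> [/sA //|[/sA h1 /sA h2]|[/sA h1 /sA h2]].
  by apply: conn_trans h1 (conn_trans ee h2).
by apply: conn_trans h1 (conn_trans (conn_sym ee) h2).
Qed.

Lemma conn0 ends x y : conn ends fset0 x y <-> x = y.
Proof.
split=> [|->]; last exact: conn_refl.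
apply: (conn_min (r := eq)) => [|e]; last by rewrite inE.
by split=> // a b c -> .
Qed.

(** [ncomp] freed from edges: it is convertible to [nclass] of [conn], and it applies to [fuse] as
    well. *)
Definition nclass (V : {fset nat}) (r : nat -> nat -> Prop) : nat :=
  #|` [fset x in V | `[< forall y, y \in V -> r x y -> (x <= y)%N >]] |.

Lemma least_rep (V : {fset nat}) (r : nat -> nat -> Prop) x : r x x -> x \in V ->
  exists m, [/\ m \in V, r x m & forall y, y \in V -> r x y -> (m <= y)%N].
Proof.
move=> rxx xV.
have exP : exists m, (m \in V) && `[< r x m >].
  by exists x; rewrite xV; apply/asboolP.
case: (ex_minnP exP) => m /andP[mV /asboolP xm] min; exists m; split=> //.
by move=> y yV xy; apply: min; rewrite yV; apply/asboolP.
Qed.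

Lemma eq_nclass V r r' :
  (forall x y, x \in V -> y \in V -> r x y <-> r' x y) ->
  nclass V r = nclass V r'.
Proof.
move=> h; rewrite /nclass; congr (#|` _|); apply/fsetP => x.
rewrite !inE; case xV: (x \in V) => //=; apply: asbool_equiv_eq.
by split=> H y yV xy; apply: H => //; apply/h.
Qed.

(** Of the least elements [ma] and [mb] of the two merged classes, only the larger one stops being a
    representative. *)
Lemma nclass_fuse V r a b : is_equiv r -> a \in V -> b \in V -> ~ r a b ->
  nclass V r = (nclass V (fuse r a b)).+1.
Proof.
move=> er aV bV; have [rr rs rt] := er.
have [ma [maV ama mina]] := least_rep (rr a) aV.
have [mb [mbV bmb minb]] := least_rep (rr b) bV.
wlog lt_ab : a b aV bV ma mb maV mbV ama bmb mina minb / (ma < mb)%N.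
  move=> IH nab; case: (ltngtP ma mb) => [lt|lt|eq].
  - exact: IH ama bmb mina minb lt nab.
  - rewrite (@eq_nclass _ (fuse r a b) (fuse r b a)).
      by apply: IH bmb ama minb mina lt _ => // /rs.
    by move=> x y _ _; apply: fuseC.
  - by case: nab; apply: rt ama _; rewrite eq; apply: rs.
move=> nab; rewrite /nclass.
set X := (X in #|` X| = _.+1); set Y := (Y in _ = (#|` Y|).+1).
have -> : X = mb |` Y; last first.
  rewrite cardfsU1; suff -> : mb \notin Y by [].
  rewrite !inE mbV /=; apply/asboolPn => /(_ ma maV) H.
  have : fuse r a b mb ma by constructor 3; split=> //; apply: rs.
  by move=> /H; rewrite leqNgt lt_ab.
apply/fsetP => x; rewrite !inE; case: eqVneq => [->|ne] /=.
  rewrite mbV; apply/asboolP => y yV mby; apply: minb => //; exact: rt mby.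
case xV: (x \in V) => //=; apply: asbool_equiv_eq; split=> H y yV.
  move=> [/H->//|[xa bz]|[xb ay]].
    apply: leq_trans (H _ maV (rt _ _ _ xa ama)) _.
    by apply: leq_trans (ltnW lt_ab) _; apply: minb.
  case/eqP: ne; apply/eqP; rewrite eqn_leq H //; last exact: rt bmb.
  by apply: minb => //; apply: rs.
by move=> xy; apply: H => //; constructor 1.
Qed.

Lemma nclass_eq V (r : nat -> nat -> Prop) :
  (forall x y, x \in V -> y \in V -> r x y -> x = y) ->
  nclass V r = #|` V|.
Proof.
move=> h; rewrite /nclass; congr (#|` _|); apply/fsetP => x.
rewrite !inE; case xV: (x \in V) => //=; apply/asboolP => y yV xy.
by rewrite (h x y).
Qed.

Definition linked ends A x y : bool := `[< conn ends A x y >].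

Lemma linkedP ends A x y : reflect (conn ends A x y) (linked ends A x y).
Proof. exact: asboolP. Qed.

Lemma ncomp_add ends V A e :
  (ends e).1 \in V -> (ends e).2 \in V ->
  ncomp ends V A = (ncomp ends V (e |` A) + ~~ linked ends A (ends e).1 (ends e).2)%N.
Proof.
move=> aV bV; rewrite -[LHS]/(nclass V (conn ends A)).
rewrite -[ncomp _ _ (e |` A)]/(nclass V (conn ends (e |` A))).
rewrite (@eq_nclass _ (conn ends (e |` A)) _ (fun x y _ _ => conn_add _ _ _ _ _)).
case: linkedP => ab /=.
  rewrite addn0; apply: eq_nclass => x y _ _.
  by apply: iff_sym; apply: fuse_rel => //; apply: conn_equiv.
by rewrite addn1; apply: nclass_fuse => //; apply: conn_equiv.
Qed.

Lemma ncomp0 ends V : ncomp ends V fset0 = #|` V|.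
Proof. by apply: nclass_eq => x y _ _ /conn0. Qed.

Definition ends_in (ends : nat -> nat * nat) (V A : {fset nat}) : Prop :=
  forall e, e \in A -> (ends e).1 \in V /\ (ends e).2 \in V.

Lemma ends_in_sub {ends V A} B : B `<=` A -> ends_in ends V A -> ends_in ends V B.
Proof. by move=> /fsubsetP BA h e /BA /h. Qed.

(* A count that drops under addition of an edge as the number of components
   of the graph with a and b identified does differs from it by a constant. *)
Lemma fuse_count (ends : nat -> nat * nat) (V E : {fset nat}) (a b : nat)
    (c : {fset nat} -> nat) :
  ends_in ends V E ->
  (forall A e, A `<=` E -> e \in E -> e \notin A ->
     c A = (c (e |` A) +
       ~~ `[< fuse (conn ends A) a b (ends e).1 (ends e).2 >])%N) ->
  forall A, A `<=` E ->
    (c A + #|` V| + (a == b) = ncomp ends V A + c fset0 + linked ends A a b)%N.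
Proof.
move=> wfE step A; elim/fset1U_rect: A => [|e A eA IH] sAE.
  rewrite ncomp0; suff -> : linked ends fset0 a b = (a == b) by lia.
  by apply/linkedP/eqP => /conn0.
have [eE sA] : e \in E /\ A `<=` E.
  by move: sAE; rewrite fsubUset fsub1set => /andP.
have [e1 e2] := wfE e eE.
have := IH sA; rewrite (step A e) // (ncomp_add A e1 e2).
have er := conn_equiv ends A.
have -> : linked ends (e |` A) a b = `[< fuse (conn ends A) (ends e).1 (ends e).2 a b >].
  exact/asbool_equiv_eq/conn_add.
rewrite /linked; set x := (ends e).1; set y := (ends e).2.
(* If [x] and [y] are joined in [A], neither count drops. If [a] and [b] are, fusing changes nothing
   and both drop. Otherwise, by exchange, [c] fails to drop exactly when [e] newly links [a] to [b],
   which the last term of the identity records. *)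
case: (pselect (conn ends A x y)) => xy.
  rewrite (asboolT xy) (asbool_equiv_eq (fuse_rel a b er xy)).
  by rewrite (@asboolT (fuse _ a b x y)); [lia | constructor 1].
case: (pselect (conn ends A a b)) => ab.
  rewrite (asboolT ab) (asbool_equiv_eq (fuse_rel x y er ab)).
  by rewrite (@asboolT (fuse _ x y a b)); [lia | constructor 1].
have -> : `[< fuse (conn ends A) a b x y >] = `[< fuse (conn ends A) x y a b >].
  by apply: asbool_equiv_eq; split; apply: fuse_exchange.
rewrite (asboolF xy) (asboolF ab); lia.
Qed.

Lemma ncomp_count (ends : nat -> nat * nat) (V E : {fset nat})
    (c : {fset nat} -> nat) :
  ends_in ends V E ->
  (forall A e, A `<=` E -> e \in E -> e \notin A ->
     c A = (c (e |` A) + ~~ linked ends A (ends e).1 (ends e).2)%N) ->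
  forall A, A `<=` E -> (c A + #|` V| = ncomp ends V A + c fset0)%N.
Proof.
move=> wfE step A sA.
(* Fusing a vertex with itself does nothing; the value 0 is arbitrary. *)
have := @fuse_count ends V E 0%N 0%N c wfE _ A sA.
rewrite eqxx (introT (linkedP _ _ _ _) (conn_refl _ _ _)) => H.
suff : (c A + #|` V| + true = ncomp ends V A + c fset0 + true)%N by lia.
apply: H => B e sB eE eB; rewrite (step B e) //; congr (_ + ~~ _)%N.
by apply: asbool_equiv_eq; apply: iff_sym; apply/fuse_id/conn_equiv.
Qed.

(** The cyclomatic number of [A] is nonnegative, so the truncated subtraction in the exponents of
    [l] never truncates. *)
Lemma card_ncomp ends V A : ends_in ends V A -> (#|` V| <= #|` A| + ncomp ends V A)%N.
Proof.
elim/fset1U_rect: A => [|e A eA IH] wfA; first by rewrite ncomp0 leq_addl.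
have [e1 e2] := wfA e (fset1U1 _ _).
have := IH (ends_in_sub (fsubsetU1 e A) wfA).
rewrite (ncomp_add A e1 e2) cardfsU1 eA; case: (~~ _); lia.
Qed.

(** Each vertex of [W] outside [V] is isolated, hence a component by itself. *)
Lemma ncomp_widen ends (V W A : {fset nat}) : V `<=` W -> ends_in ends V A ->
  (ncomp ends W A + #|` V| = ncomp ends V A + #|` W|)%N.
Proof.
move=> /fsubsetP VW wfA; rewrite -(ncomp0 ends W).
apply: (@ncomp_count ends V A (ncomp ends W)) (fsubset_refl _) => // B e _ eA _.
by have [e1 e2] := wfA e eA; apply: ncomp_add; apply: VW.
Qed.

(** * Flow sums *)

Lemma fpowersetU1 (K : choiceType) (e : K) (E : {fset K}) :
  fpowerset (e |` E) = fpowerset E `|` [fset e |` A | A in fpowerset E].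
Proof.
apply/fsetP => A; rewrite !inE !fpowersetE; apply/idP/orP => [sA|[sA|]].
- case: (boolP (e \in A)) => eA; last first.
    left; apply/fsubsetP => x xA; have := fsubsetP sA x xA.
    by rewrite !inE; case: eqP xA eA => [->->|].
  right; apply/imfsetP; exists (A `\ e); last by rewrite fsetD1K.
  by rewrite /= fpowersetE fsubDset.
- exact: fsubset_trans sA (fsubsetU1 _ _).
- by case/imfsetP => B /=; rewrite fpowersetE => sB ->; apply: fsetUS.
Qed.

Lemma big_fpowersetU1 (M : nmodType) (K : choiceType) (e : K) (E : {fset K})
    (g : {fset K} -> M) : e \notin E ->
  (\sum_(A <- fpowerset (e |` E)) g A =
   \sum_(A <- fpowerset E) g A + \sum_(A <- fpowerset E) g (e |` A))%R.
Proof.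
move=> eE; rewrite fpowersetU1 (big_fsetID _ (mem (fpowerset E))) /=.
have notin A : A `<=` E -> e \notin A.
  by move=> /fsubsetP sA; apply: contra eE; apply: sA.
congr (_ + _)%R.
  by apply: eq_fbigl => A; rewrite !inE; case: (A \in fpowerset E); rewrite ?andbT ?andbF.
rewrite (_ : [fset x in _ | _] = [fset e |` A | A in fpowerset E]); last first.
  apply/fsetP => A; rewrite !inE andb_orl andbN /=.
  apply/andP/idP => [[] //|h]; split=> //.
  case/imfsetP: h => B /= _ ->; apply/negP; rewrite fpowersetE => /notin.
  by rewrite fset1U1.
rewrite big_imfset //= => A B; rewrite !fpowersetE => /notin eA /notin eB.
by move=> /(congr1 (fun X => X `\ e)); rewrite !fsetU1K.
Qed.

Lemma big_fpowersetU (M : nmodType) (K : choiceType) (E1 E2 : {fset K})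
    (g : {fset K} -> M) : E1 `&` E2 = fset0 ->
  (\sum_(A <- fpowerset (E1 `|` E2)) g A =
   \sum_(A <- fpowerset E1) \sum_(B <- fpowerset E2) g (A `|` B))%R.
Proof.
elim/fset1U_rect: E1 g => [|e E1 eE1 IH] g dis.
  rewrite fpowerset0 big_seq_fset1 fset0U.
  by apply: eq_bigr => A _; rewrite fset0U.
have eE : e \notin E1 `|` E2.
  rewrite inE negb_or eE1; apply/negP => e2.
  by move/fsetP/(_ e): dis; rewrite !inE eqxx e2.
have dis' : E1 `&` E2 = fset0.
  by move: dis; rewrite fsetIUl => /eqP; rewrite fsetU_eq0 => /andP[_ /eqP].
rewrite -fsetUA !big_fpowersetU1 // !IH //; congr (_ + _)%R.
by apply: eq_bigr => A _; apply: eq_bigr => B _; rewrite fsetUA.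
Qed.

Definition wt (R : realType) (l : R) ends (V E A : {fset nat}) : R :=
  ((-1) ^+ (#|` E| - #|` A|) * l ^+ (#|` A| + ncomp ends V A - #|` V|))%R.

Definition flow (R : realType) (l : R) ends (V E : {fset nat}) : R :=
  (\sum_(A <- fpowerset E) wt l ends V E A)%R.

(* For u <> v, this is the number of nowhere-zero flows of value 1 from u to v
   when l is the order of the group. *)
Definition pflow (R : realType) (l : R) ends (V E : {fset nat}) (u v : nat) : R :=
  (\sum_(A <- fpowerset E) (linked ends A u v)%:R * wt l ends V E A)%R.

Lemma flowpolyE (R : realType) (G : graph) (l : R) :
  flowpoly G l = flow l (gends G) (gV G) (gE G).
Proof. by []. Qed.

Lemma eq_sum_fpowerset (M : nmodType) (K : choiceType) (E : {fset K})
    (g h : {fset K} -> M) : (forall A, A `<=` E -> g A = h A) ->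
  (\sum_(A <- fpowerset E) g A = \sum_(A <- fpowerset E) h A)%R.
Proof. by move=> gh; apply: eq_fbigr => A; rewrite fpowersetE => /gh. Qed.

Lemma eq_linked ends ends' (A : {fset nat}) x y : {in A, ends =1 ends'} ->
  linked ends A x y = linked ends' A x y.
Proof. by move=> eq; apply/asbool_equiv_eq/conn_ext. Qed.

Lemma eq_wt (R : realType) (l : R) ends ends' V E (A : {fset nat}) :
  {in A, ends =1 ends'} -> wt l ends V E A = wt l ends' V E A.
Proof.
move=> eq; rewrite /wt (_ : ncomp ends V A = ncomp ends' V A) //.
by apply: eq_nclass => x y _ _; apply: conn_ext.
Qed.

Lemma eq_pflow (R : realType) (l : R) ends ends' V (E : {fset nat}) u v :
  {in E, ends =1 ends'} -> pflow l ends V E u v = pflow l ends' V E u v.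
Proof.
move=> eq; apply: eq_sum_fpowerset => A /fsubsetP sA.
have eqA : {in A, ends =1 ends'} by move=> e /sA /eq.
by rewrite (eq_wt _ _ _ eqA) (eq_linked _ _ eqA).
Qed.

Lemma eq_flow (R : realType) (l : R) ends ends' V (E : {fset nat}) :
  {in E, ends =1 ends'} -> flow l ends V E = flow l ends' V E.
Proof.
move=> eq; apply: eq_sum_fpowerset => A /fsubsetP sA.
by apply: eq_wt => e /sA /eq.
Qed.

Lemma wt_notin (R : realType) (l : R) ends V (E A : {fset nat}) e :
  e \notin E -> A `<=` E -> wt l ends V (e |` E) A = (- wt l ends V E A)%R.
Proof.
move=> eE /fsubset_leq_card cA; rewrite /wt cardfsU1 eE addnC addn1 subSn //.
by rewrite exprS mulN1r mulNr.
Qed.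

(** The sign is unchanged, and the power of [l] grows by one exactly when [e] closes a cycle.
    Writing l w as w + (l-1) w lets the first part cancel against the term of the same set without
    [e]. *)
Lemma wt_in (R : realType) (l : R) ends V (E A : {fset nat}) e :
  e \notin E -> A `<=` E -> ends_in ends V (e |` E) ->
  wt l ends V (e |` E) (e |` A) =
    (wt l ends V E A + (linked ends A (ends e).1 (ends e).2)%:R *
       (l - 1) * wt l ends V E A)%R.
Proof.
move=> eE sA wfE; have eA : e \notin A by apply: contra eE; apply: (fsubsetP sA).
have [e1 e2] := wfE e (fset1U1 _ _).
have := card_ncomp (ends_in_sub (fsubset_trans sA (fsubsetU1 e E)) wfE).
rewrite /wt !cardfsU1 eE eA subnDl (ncomp_add A e1 e2).
set c := ncomp _ _ _; case: linked => /= cA.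
  by rewrite addn0 in cA *; rewrite add1n addSn subSn // exprS;
    move: (_ ^+ _)%R (l ^+ _)%R => s p; ring.
by rewrite add1n addSnnS -[c.+1]addn1 mul0r mul0r addr0.
Qed.

Lemma flow_edge (R : realType) (l : R) ends V E e :
  e \notin E -> ends_in ends V (e |` E) ->
  flow l ends V (e |` E) = ((l - 1) * pflow l ends V E (ends e).1 (ends e).2)%R.
Proof.
move=> eE wfE; rewrite /flow big_fpowersetU1 // /pflow mulr_sumr -big_split /=.
apply: eq_sum_fpowerset => A sA; rewrite wt_notin // wt_in //.
by move: (wt _ _ _ _ _) (linked _ _ _ _)%:R%R => w b; ring.
Qed.

(** Sets containing [e] always link its ends and give [flow] plus l - 1 times [pflow]; sets avoiding
    [e] take away one [pflow]. This is the origin of l - 2. *)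
Lemma pflow_edge (R : realType) (l : R) ends V E e :
  e \notin E -> ends_in ends V (e |` E) ->
  pflow l ends V (e |` E) (ends e).1 (ends e).2 =
    (flow l ends V E + (l - 2) * pflow l ends V E (ends e).1 (ends e).2)%R.
Proof.
move=> eE wfE; rewrite /flow {1}/pflow big_fpowersetU1 // /pflow mulr_sumr.
rewrite -!big_split /=; apply: eq_sum_fpowerset => A sA.
rewrite wt_notin // wt_in //.
rewrite (_ : linked ends (e |` A) _ _ = true); last first.
  by apply/linkedP/conn_edge/fset1U1.
rewrite mulr1n mul1r.
by move: (wt _ _ _ _ _) (linked _ _ _ _)%:R%R => w b; ring.
Qed.

Lemma renV (V : {fset nat}) u v x : u != v -> u \in V -> x \in V ->
  ren u v x \in V `\ v.
Proof.
by move=> uv uV xV; rewrite /ren !inE; case: (eqVneq x v) => [_|->]; rewrite ?uv.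
Qed.

Lemma conn_ren ends A u v x y :
  conn (fun f => (ren u v (ends f).1, ren u v (ends f).2)) A (ren u v x) (ren u v y)
  <-> fuse (conn ends A) u v x y.
Proof.
set ends' := fun f => _; have er := conn_equiv ends A.
have em := fuse_equiv u v er; have [mr ms mt] := em.
have mren z : fuse (conn ends A) u v (ren u v z) z.
  by rewrite /ren; case: eqP => [->|_]; [apply: fuse_pair|].
split=> [h|].
  apply: (mt _ _ _ (ms _ _ (mren x)) (mt _ _ _ _ (mren y))).
  apply: (conn_min em) h => e eA /=.
  apply: (mt _ _ _ (mren _) (mt _ _ _ _ (ms _ _ (mren _)))).
  by constructor 1; apply: conn_edge.
have H x' y' : conn ends A x' y' -> conn ends' A (ren u v x') (ren u v y').
  by apply: conn_map; [apply: conn_equiv|move=> e; apply: (@conn_edge ends')].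
have ru : ren u v v = ren u v u by rewrite /ren eqxx; case: eqP.
by move=> [/H //|[/H h1 /H h2]|[/H h1 /H h2]]; apply: (conn_trans h1);
  [rewrite -ru|rewrite ru].
Qed.

(** The components after identification are the classes of [fuse], so [fuse_count] applies with [c]
    their number. *)
Lemma ncomp_identify ends V E A u v : ends_in ends V E -> A `<=` E ->
  u != v -> u \in V -> v \in V ->
  (ncomp (fun f => (ren u v (ends f).1, ren u v (ends f).2)) (V `\ v) A + 1 =
   ncomp ends V A + linked ends A u v)%N.
Proof.
move=> wfE sA uv uV vV; set ends' := fun f => _.
have := @fuse_count ends V E u v (ncomp ends' (V `\ v)) wfE _ A sA.
rewrite (negbTE uv) ncomp0.
have := cardfsD1 v V; rewrite vV => -> H.
suff : (ncomp ends' (V `\ v) A + (true + #|` V `\ v|) + false =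
   ncomp ends V A + #|` V `\ v| + linked ends A u v)%N by lia.
apply: H => B e _ eE _; have [e1 e2] := wfE e eE.
rewrite (@ncomp_add ends' _ B e) ?renV //; congr (_ + ~~ _)%N.
exact/asbool_equiv_eq/conn_ren.
Qed.

Lemma flow_identify (R : realType) (l : R) ends V E u v :
  ends_in ends V E -> u != v -> u \in V -> v \in V ->
  flow l (fun f => (ren u v (ends f).1, ren u v (ends f).2)) (V `\ v) E =
    (flow l ends V E + (l - 1) * pflow l ends V E u v)%R.
Proof.
move=> wfE uv uV vV; rewrite /flow /pflow mulr_sumr -big_split /=.
apply: eq_sum_fpowerset => A sA; rewrite /wt.
have eqn (a n m c d : nat) (b : bool) : n = (true + m)%N -> (n <= a + c)%N ->
  (d + 1 = c + b)%N -> (a + d - m = b + (a + c - n))%N by lia.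
have cV := cardfsD1 v V; rewrite vV in cV.
rewrite (eqn _ _ _ _ _ _ cV (card_ncomp (ends_in_sub sA wfE))
  (ncomp_identify wfE sA uv uV vV)) exprD.
by case: linked; move: (_ ^+ (_ - _))%R (l ^+ (_ - _))%R => s p;
  rewrite ?expr1 ?mul1r ?mul0r ?mulr0 ?addr0 //; ring.
Qed.

(** * Components of glued graphs *)

(** For graphs glued at [v], this fixes one side and shrinks every edge of the other side to [v], so
    paths of the union map to paths of one side. *)
Definition retract (V : {fset nat}) (v z : nat) : nat := if z \in V then z else v.

Lemma retract_in V v z : z \in V -> retract V v z = z.
Proof. by rewrite /retract => ->. Qed.

Lemma retract_glue (V1 V2 : {fset nat}) v z : V1 `&` V2 = [fset v] -> z \in V2 ->
  retract V1 v z = v.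
Proof.
move=> /fsetP/(_ z); rewrite !inE /retract => + zV; rewrite zV andbT => ->.
by case: eqP.
Qed.

Lemma conn_glue1_retract ends (V1 V2 A1 A2 : {fset nat}) (v : nat) x y : V1 `&` V2 = [fset v] ->
  ends_in ends V1 A1 -> ends_in ends V2 A2 -> conn ends (A1 `|` A2) x y ->
  conn ends A1 (retract V1 v x) (retract V1 v y).
Proof.
move=> V12 w1 w2; apply: conn_map; first exact: conn_equiv.
move=> e; rewrite inE => /orP[eA|/w2[e1 e2]].
  by have [e1 e2] := w1 e eA; rewrite !retract_in //; apply: conn_edge.
by rewrite !(retract_glue V12) //; apply: conn_refl.
Qed.

Lemma conn_glue1 ends (V1 V2 A1 A2 : {fset nat}) (v : nat) x y : V1 `&` V2 = [fset v] ->
  ends_in ends V1 A1 -> ends_in ends V2 A2 -> x \in V1 -> y \in V1 ->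
  conn ends (A1 `|` A2) x y <-> conn ends A1 x y.
Proof.
move=> V12 w1 w2 x1 y1; split; last exact/conn_mono/fsubsetUl.
by move=> /(conn_glue1_retract V12 w1 w2); rewrite !retract_in.
Qed.

Lemma conn_glue1_across ends (V1 V2 A1 A2 : {fset nat}) (v : nat) x y : V1 `&` V2 = [fset v] ->
  ends_in ends V1 A1 -> ends_in ends V2 A2 -> x \in V1 -> y \in V2 ->
  conn ends (A1 `|` A2) x y <-> conn ends A1 x v /\ conn ends A2 v y.
Proof.
move=> V12 w1 w2 x1 y2; have V21 : V2 `&` V1 = [fset v] by rewrite fsetIC.
split=> [h|[h1 h2]]; last first.
  apply: conn_trans (conn_mono _ h1) (conn_mono _ h2).
    exact: fsubsetUl.
  exact: fsubsetUr.
split.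
  by have := conn_glue1_retract V12 w1 w2 h; rewrite (retract_glue V12 y2) retract_in.
rewrite fsetUC in h.
by have := conn_glue1_retract V21 w2 w1 h; rewrite (retract_glue V21 x1) retract_in.
Qed.

Lemma card_glue (V1 V2 X : {fset nat}) : V1 `&` V2 = X ->
  (#|` V1 `|` V2| + #|` X| = #|` V1| + #|` V2|)%N.
Proof. by move=> <-; apply: cardfsUI. Qed.

(** With [A2] fixed, an edge of [A1] merges two components of the union exactly when it merges two
    components of side 1, so both counts drop together. *)
Lemma ncomp_glue1 ends (V1 V2 A1 A2 : {fset nat}) (v : nat) : V1 `&` V2 = [fset v] ->
  ends_in ends V1 A1 -> ends_in ends V2 A2 ->
  (ncomp ends (V1 `|` V2) (A1 `|` A2) + 1 = ncomp ends V1 A1 + ncomp ends V2 A2)%N.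
Proof.
move=> V12 w1 w2; have := card_glue V12; rewrite cardfs1.
have := ncomp_widen (fsubsetUr V1 V2) w2.
have := @ncomp_count ends V1 A1 (fun A => ncomp ends (V1 `|` V2) (A `|` A2)) w1 _ A1
  (fsubset_refl _).
rewrite fset0U => H; have {}H := H _.
suff : (ncomp ends (V1 `|` V2) (A1 `|` A2) + #|` V1|)%N =
  (ncomp ends V1 A1 + ncomp ends (V1 `|` V2) A2)%N by lia.
apply: H => B e sB eA _; have [e1 e2] := w1 e eA.
rewrite -fsetUA (@ncomp_add ends _ (B `|` A2) e); last 2 first.
- by rewrite inE e1.
- by rewrite inE e2.
congr (_ + ~~ _)%N; apply: asbool_equiv_eq.
by apply: conn_glue1 V12 _ w2 e1 e2; apply: ends_in_sub w1.
Qed.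

Lemma conn_glue2 ends (V1 V2 A1 A2 : {fset nat}) (a b : nat) x y : V1 `&` V2 = [fset a; b] ->
  ends_in ends V1 A1 -> ends_in ends V2 A2 -> x \in V1 -> y \in V1 ->
  conn ends (A1 `|` A2) x y <->
  if linked ends A2 a b then fuse (conn ends A1) a b x y else conn ends A1 x y.
Proof.
move=> V12 w1 w2 x1 y1; have er := conn_equiv ends A1.
have [rr rs rt] := fuse_equiv a b er.
have sl x' y' := @conn_mono ends _ _ x' y' (fsubsetUl A1 A2).
have in12 z : z \in V1 -> z \in V2 -> z = a \/ z = b.
  move=> z1 z2; move/fsetP/(_ z): V12; rewrite !inE z1 z2 => /esym/orP[] /eqP;
  by [left|right].
have [aV bV] : a \in V1 /\ b \in V1.
  by split; [move/fsetP/(_ a): V12|move/fsetP/(_ b): V12];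
    rewrite !inE eqxx ?orbT => /andP[].
case: linkedP => ab; split; last exact: sl.
- have H z : z \in V2 -> fuse (conn ends A1) a b a (retract V1 a z).
    move=> z2; rewrite /retract; case: ifP => // z1.
    by case: (in12 z z1 z2) => -> //; apply: fuse_pair.
  rewrite -{2}(retract_in a x1) -{2}(retract_in a y1); apply: conn_map => //.
  move=> e; rewrite inE => /orP[eA|/w2[e1 e2]].
    have [e1 e2] := w1 e eA; rewrite !retract_in //; constructor 1.
    exact: conn_edge.
  by apply: rt (H _ e2); apply: rs; apply: H.
- have ab' : conn ends (A1 `|` A2) a b by apply: conn_mono ab; apply: fsubsetUr.
  move=> [/sl //|[/sl h1 /sl h2]|[/sl h1 /sl h2]].
    exact: conn_trans h1 (conn_trans ab' h2).
  exact: conn_trans h1 (conn_trans (conn_sym ab') h2).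
(* No edge of [A2] leaves the component of [b] in side 2. Sending that component to [b] and the rest
   to [a] shrinks every edge of [A2] to a point and agrees with the identity on [V1]. *)
pose phi z := if z \in V1 then z else if linked ends A2 z b then b else a.
have H z : z \in V2 -> phi z = if linked ends A2 z b then b else a.
  move=> z2; rewrite /phi; case: ifP => // z1.
  case: (in12 z z1 z2) => ->; first by case: linkedP.
  by case: linkedP => // /(_ (conn_refl _ _ _)).
have p1 z : z \in V1 -> phi z = z by rewrite /phi => ->.
rewrite -{2}(p1 x x1) -{2}(p1 y y1); apply: conn_map => //.
move=> e; rewrite inE => /orP[eA|eA].
  by have [e1 e2] := w1 e eA; rewrite !p1 //; apply: conn_edge.
have [e1 e2] := w2 e eA; rewrite !H //.
rewrite (_ : linked _ _ (ends e).1 b = linked ends A2 (ends e).2 b) //.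
  exact: conn_refl.
have ee := conn_edge ends eA.
by apply: asbool_equiv_eq; split; apply: conn_trans => //; apply: conn_sym.
Qed.

(** Side 1 sees [A2] only through whether it links [a] and [b]: if so, edges of [A1] act modulo the
    fusion of [a] and [b], otherwise as if [A2] were absent. *)
Lemma ncomp_glue2 ends (V1 V2 A1 A2 : {fset nat}) (a b : nat) : V1 `&` V2 = [fset a; b] -> a != b ->
  ends_in ends V1 A1 -> ends_in ends V2 A2 ->
  (ncomp ends (V1 `|` V2) (A1 `|` A2) + 2 =
   ncomp ends V1 A1 + ncomp ends V2 A2 + linked ends A1 a b && linked ends A2 a b)%N.
Proof.
move=> V12 ab w1 w2; have := card_glue V12; rewrite cardfs2 ab.
have := ncomp_widen (fsubsetUr V1 V2) w2.
pose c A := ncomp ends (V1 `|` V2) (A `|` A2).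
have c0 : c fset0 = ncomp ends (V1 `|` V2) A2 by rewrite /c fset0U.
have step B e : B `<=` A1 -> e \in A1 ->
    c B = (c (e |` B) + ~~ linked ends (B `|` A2) (ends e).1 (ends e).2)%N.
  move=> sB eA; have [e1 e2] := w1 e eA.
  by rewrite /c -fsetUA; apply: ncomp_add; rewrite inE ?e1 ?e2.
have link B e : B `<=` A1 -> e \in A1 ->
    conn ends (B `|` A2) (ends e).1 (ends e).2 <-> _ := fun sB eA =>
    conn_glue2 V12 (ends_in_sub sB w1) w2 (w1 e eA).1 (w1 e eA).2.
have eqn (p q r s t n m k : nat) : (p + n = q + s + k)%N -> (s + m = r + t)%N ->
  (t + 2 = n + m)%N -> (p + 2 = q + r + k)%N by lia.
rewrite -c0 -/(c A1); case: linkedP link => /= ab2 link e1 e2.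
  rewrite andbT; apply: (eqn _ _ _ _ _ _ _ _ _ e1 e2).
  have := @fuse_count ends V1 A1 a b c w1 _ A1 (fsubset_refl _).
  rewrite (negbTE ab) addn0; apply=> B e sB eA _.
  rewrite (step B e) //; congr (_ + ~~ _)%N; exact/asbool_equiv_eq/link.
rewrite andbF; apply: (eqn _ _ _ _ _ _ _ _ _ e1 e2); rewrite addn0.
apply: ncomp_count w1 _ _ (fsubset_refl _) => B e sB eA _.
by rewrite (step B e) //; congr (_ + ~~ _)%N; exact/asbool_equiv_eq/link.
Qed.

(** * Flow polynomials of glued and modified graphs *)

Lemma disjoint_sub (E1 E2 A1 A2 : {fset nat}) : E1 `&` E2 = fset0 ->
  A1 `<=` E1 -> A2 `<=` E2 -> A1 `&` A2 = fset0.
Proof.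
by move=> dis s1 s2; apply/eqP; rewrite -fsubset0 -dis; apply: fsetISS.
Qed.

Lemma card_disjointU (E1 E2 : {fset nat}) : E1 `&` E2 = fset0 ->
  #|` E1 `|` E2| = (#|` E1| + #|` E2|)%N.
Proof. by move=> dis; have := cardfsUI E1 E2; rewrite dis cardfs0 addn0. Qed.

Lemma wt_glue1 (R : realType) (l : R) ends (V1 V2 E1 E2 A1 A2 : {fset nat}) (v : nat) :
  V1 `&` V2 = [fset v] -> E1 `&` E2 = fset0 ->
  ends_in ends V1 E1 -> ends_in ends V2 E2 -> A1 `<=` E1 -> A2 `<=` E2 ->
  wt l ends (V1 `|` V2) (E1 `|` E2) (A1 `|` A2) =
  (wt l ends V1 E1 A1 * wt l ends V2 E2 A2)%R.
Proof.
move=> V12 dis w1 w2 s1 s2; have {}w1 := ends_in_sub s1 w1.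
have {}w2 := ends_in_sub s2 w2; have := ncomp_glue1 V12 w1 w2.
have := card_glue V12; rewrite cardfs1.
have := fsubset_leq_card s1; have := fsubset_leq_card s2.
have := card_ncomp w1; have := card_ncomp w2.
rewrite /wt (card_disjointU dis) (card_disjointU (disjoint_sub dis s1 s2)).
move: #|` _| #|` _| #|` _| #|` _| #|` _| #|` _| #|` _| (ncomp _ _ _) (ncomp _ _ _)
  (ncomp _ _ _) => a1 a2 b1 b2 m m1 m2 c c1 c2 *.
rewrite mulrACA -!exprD; congr (_ ^+ _ * _ ^+ _)%R; lia.
Qed.

(** When both sides link [a] and [b], the union has one independent cycle more than its parts
    together; the resulting factor [l] is split as 1 + (l-1). *)
Lemma wt_glue2 (R : realType) (l : R) ends (V1 V2 E1 E2 A1 A2 : {fset nat}) (a b : nat) :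
  V1 `&` V2 = [fset a; b] -> a != b -> E1 `&` E2 = fset0 ->
  ends_in ends V1 E1 -> ends_in ends V2 E2 -> A1 `<=` E1 -> A2 `<=` E2 ->
  wt l ends (V1 `|` V2) (E1 `|` E2) (A1 `|` A2) =
  (wt l ends V1 E1 A1 * wt l ends V2 E2 A2 +
   (l - 1) * ((linked ends A1 a b)%:R * wt l ends V1 E1 A1) *
     ((linked ends A2 a b)%:R * wt l ends V2 E2 A2))%R.
Proof.
move=> V12 ab dis w1 w2 s1 s2; have {}w1 := ends_in_sub s1 w1.
have {}w2 := ends_in_sub s2 w2; have := ncomp_glue2 V12 ab w1 w2.
have := card_glue V12; rewrite cardfs2 ab.
have := fsubset_leq_card s1; have := fsubset_leq_card s2.
have := card_ncomp w1; have := card_ncomp w2.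
rewrite /wt (card_disjointU dis) (card_disjointU (disjoint_sub dis s1 s2)).
move: #|` E1| #|` E2| #|` A1| #|` A2| #|` V1 `|` V2| #|` V1| #|` V2|
  (ncomp _ (_ `|` _) _) (ncomp _ V1 _) (ncomp _ V2 _)
  (linked _ A1 _ _) (linked _ A2 _ _)
  => a1 a2 b1 b2 m m1 m2 c c1 c2 k1 k2 h1 h2 h3 h4 h5 h6.
have -> : (a1 + a2 - (b1 + b2) = (a1 - b1) + (a2 - b2))%N by lia.
have -> : (b1 + b2 + c - m = (k1 && k2) + ((b1 + c1 - m1) + (b2 + c2 - m2)))%N by lia.
rewrite !exprD; move: ((-1) ^+ _)%R ((-1) ^+ _)%R (l ^+ (_ - _))%R (l ^+ (_ - _))%R.
by move=> x1 x2 y1 y2; case: k1 k2 {h6} => -[] /=; rewrite ?expr1 ?expr0 ?mulr1n ?mulr0n; ring.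
Qed.

Lemma flow_glue1 (R : realType) (l : R) ends (V1 V2 E1 E2 : {fset nat}) (v : nat) :
  V1 `&` V2 = [fset v] -> E1 `&` E2 = fset0 ->
  ends_in ends V1 E1 -> ends_in ends V2 E2 ->
  flow l ends (V1 `|` V2) (E1 `|` E2) = (flow l ends V1 E1 * flow l ends V2 E2)%R.
Proof.
move=> V12 dis w1 w2; rewrite /flow big_fpowersetU // mulr_suml.
apply: eq_sum_fpowerset => A sA; rewrite mulr_sumr.
by apply: eq_sum_fpowerset => B sB; apply: (wt_glue1 _ V12).
Qed.

Lemma flow_glue2 (R : realType) (l : R) ends (V1 V2 E1 E2 : {fset nat}) (a b : nat) :
  V1 `&` V2 = [fset a; b] -> a != b -> E1 `&` E2 = fset0 ->
  ends_in ends V1 E1 -> ends_in ends V2 E2 ->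
  flow l ends (V1 `|` V2) (E1 `|` E2) =
  (flow l ends V1 E1 * flow l ends V2 E2 +
   (l - 1) * pflow l ends V1 E1 a b * pflow l ends V2 E2 a b)%R.
Proof.
move=> V12 ab dis w1 w2; rewrite /flow /pflow big_fpowersetU // mulr_suml.
rewrite -mulrA [X in (_ + _ * X)%R]mulr_suml [X in (_ + X)%R]mulr_sumr -big_split /=.
apply: eq_sum_fpowerset => A sA; rewrite !mulr_sumr -big_split /=.
by apply: eq_sum_fpowerset => B sB; rewrite mulrA; apply: (wt_glue2 _ V12).
Qed.

Lemma pflow_glue1 (R : realType) (l : R) ends (V1 V2 E1 E2 : {fset nat}) (v x y : nat) :
  V1 `&` V2 = [fset v] -> E1 `&` E2 = fset0 ->
  ends_in ends V1 E1 -> ends_in ends V2 E2 -> x \in V1 -> y \in V2 ->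
  pflow l ends (V1 `|` V2) (E1 `|` E2) x y =
  (pflow l ends V1 E1 x v * pflow l ends V2 E2 v y)%R.
Proof.
move=> V12 dis w1 w2 x1 y2; rewrite /pflow big_fpowersetU // mulr_suml.
apply: eq_sum_fpowerset => A sA; rewrite mulr_sumr.
apply: eq_sum_fpowerset => B sB; rewrite (wt_glue1 _ V12) // [RHS]mulrACA.
rewrite -natrM mulnb.
congr (_%:R * _)%R; congr nat_of_bool; rewrite /linked -asbool_and.
apply: asbool_equiv_eq.
by apply: conn_glue1_across V12 _ _ x1 y2; [apply: ends_in_sub w1|apply: ends_in_sub w2].
Qed.

Lemma fresh_notin (E : {fset nat}) : fresh E \notin E.
Proof.
apply/negP => /= h; have := @leq_bigmax_seq _ (enum_fset E) xpredT id _ h isT.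
by rewrite /fresh ltnn.
Qed.

Definition gpflow (R : realType) (l : R) (G : graph) (u v : nat) : R :=
  pflow l (gends G) (gV G) (gE G) u v.

Lemma wf_add (G : graph) u v : wf G -> u \in gV G -> v \in gV G -> wf (add_edge G u v).
Proof.
move=> wG uV vV e /=; rewrite !inE; case: eqP => //= _ /wG //.
Qed.

Lemma wf_del (G : graph) e : wf G -> wf (del_edge G e).
Proof. by move=> wG f /=; rewrite !inE => /andP[_ /wG]. Qed.

Lemma flowpoly_del (R : realType) (l : R) (G : graph) e : wf G -> e \in gE G ->
  flowpoly G l = ((l - 1) * gpflow l (del_edge G e) (gends G e).1 (gends G e).2)%R.
Proof.
move=> wG eE; rewrite flowpolyE -{1}(fsetD1K eE) flow_edge //.
  by rewrite !inE eqxx.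
by rewrite fsetD1K.
Qed.

Lemma add_endsE (G : graph) u v : {in gE G, gends (add_edge G u v) =1 gends G}.
Proof. by move=> e eE /=; case: eqP eE (fresh_notin (gE G)) => // -> ->. Qed.

Lemma flowpoly_add (R : realType) (l : R) (G : graph) u v : wf G ->
  u \in gV G -> v \in gV G ->
  flowpoly (add_edge G u v) l = ((l - 1) * gpflow l G u v)%R.
Proof.
move=> wG uV vV; rewrite flowpolyE /= flow_edge /=; last 2 first.
- exact: fresh_notin.
- exact: wf_add.
by rewrite eqxx /= (eq_pflow _ _ _ _ (@add_endsE G u v)).
Qed.

Lemma flowpoly_add2 (R : realType) (l : R) (G : graph) u v : wf G ->
  u \in gV G -> v \in gV G ->
  flowpoly (add2_edge G u v) l =
  ((l - 1) * (flowpoly G l + (l - 2) * gpflow l G u v))%R.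
Proof.
move=> wG uV vV; rewrite flowpoly_add //; last exact: wf_add.
congr (_ * _)%R; rewrite /gpflow.
have := @pflow_edge R l (gends (add_edge G u v)) (gV G) (gE G) (fresh (gE G))
  (fresh_notin _) (@wf_add G u v wG uV vV).
rewrite /= eqxx /= => ->.
rewrite (eq_pflow _ _ _ _ (@add_endsE G u v)).
by rewrite (eq_flow _ _ (@add_endsE G u v)) flowpolyE.
Qed.

Lemma flowpoly_identify (R : realType) (l : R) (G : graph) u v : wf G ->
  u != v -> u \in gV G -> v \in gV G ->
  flowpoly (identify G u v) l = (flowpoly G l + (l - 1) * gpflow l G u v)%R.
Proof.
by move=> wG uv uV vV; rewrite flowpolyE /= (negbTE uv) flow_identify.
Qed.

Lemma flowpoly_contract (R : realType) (l : R) (G : graph) e : wf G ->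
  e \in gE G -> ~~ is_loop G e ->
  flowpoly (contract G e) l = (flowpoly (del_edge G e) l + flowpoly G l)%R.
Proof.
move=> wG eE nl; have [e1 e2] := wG e eE.
rewrite /contract flowpoly_identify //; last exact: wf_del.
by rewrite (flowpoly_del _ wG eE).
Qed.

(** * Cut vertices and blocks *)

Lemma nclass1 (V : {fset nat}) (r : nat -> nat -> Prop) : is_equiv r -> V != fset0 ->
  (forall x y, x \in V -> y \in V -> r x y) -> nclass V r = 1%N.
Proof.
move=> [rr _ _] /fset0Pn[x0 x0V] all; have [m [mV _ mmin]] := least_rep (rr x0) x0V.
have min y : y \in V -> (m <= y)%N by move=> yV; apply/mmin/all.
rewrite /nclass (_ : [fset _ in _ | _] = [fset m]) ?cardfs1 //.
apply/fsetP => x; rewrite !inE; apply/andP/eqP => [[xV /asboolP h]|->].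
  by apply/eqP; rewrite eqn_leq min // h //; apply: all.
by split=> //; apply/asboolP => y yV _; apply: min.
Qed.

Lemma nclass_gt1 (V : {fset nat}) (r : nat -> nat -> Prop) x y : is_equiv r ->
  x \in V -> y \in V -> ~ r x y -> (1 < nclass V r)%N.
Proof.
move=> [rr rs rt] xV yV nxy.
have [mx [mxV xmx mxmin]] := least_rep (rr x) xV.
have [my [myV ymy mymin]] := least_rep (rr y) yV.
have ne : mx != my.
  by apply/eqP => e; apply: nxy; apply: (rt _ _ _ xmx); rewrite e; apply: rs.
have := cardfs2 mx my; rewrite ne => <-; apply: fsubset_leq_card.
apply/fsubsetP => z; rewrite !inE => /orP[]/eqP->; rewrite ?mxV ?myV /=;
  apply/asboolP => t tV h.
  by apply: mxmin => //; apply: (rt _ _ _ xmx).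
by apply: mymin => //; apply: (rt _ _ _ ymy).
Qed.

Lemma comps_connected G : connected G -> comps G = 1%N.
Proof.
move=> [_ [V0 cG]]; apply: (nclass1 (conn_equiv _ _) V0) => x y xV yV.
exact: cG.
Qed.

Lemma del_vertexE G v e : (e \in gE (del_vertex G v)) =
  [&& e \in gE G, (gends G e).1 != v & (gends G e).2 != v].
Proof. by rewrite /= !inE. Qed.

Lemma cut_vertexP G v : connected G -> is_cut_vertex G v <->
  v \in gV G /\ exists x y, [/\ x \in gV G, y \in gV G, x != v, y != v &
    ~ conn (gends G) (gE (del_vertex G v)) x y].
Proof.
move=> cG; rewrite /is_cut_vertex (comps_connected cG); split=> -[vV].
  move=> lt; split=> //; apply: contrapT => nex.
  have all x y : x \in gV G `\ v -> y \in gV G `\ v ->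
      conn (gends G) (gE (del_vertex G v)) x y.
    rewrite !inE => /andP[xv xV] /andP[yv yV]; apply: contrapT => nxy.
    by apply: nex; exists x, y.
  (* If [v] is the only vertex, its deletion leaves no component at all, against [lt]. *)
  case: (eqVneq (gV G `\ v) fset0) => [V0|V0].
    by move: lt; rewrite /comps /ncomp /= V0 (_ : [fset _ in _ | _] = fset0) //;
      apply/fsetP => z; rewrite !inE.
  have := nclass1 (conn_equiv _ _) V0 all.
  by move: lt; rewrite /comps -[ncomp _ _ _]/(nclass (gV G `\ v) _) => + e; rewrite e.
move=> [x [y [xV yV xv yv nxy]]]; split=> //.
by apply: (nclass_gt1 (conn_equiv _ _) _ _ nxy); rewrite /= !inE ?xv ?yv.
Qed.

(** One notion for both kinds of separation: [X] is a singleton at a cut vertex and a pair in (c)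
    and (d). *)
Definition glued (G H1 H2 : graph) (X : {fset nat}) : Prop :=
  [/\ subgraph H1 G, subgraph H2 G, gV H1 `&` gV H2 = X, gV H1 `|` gV H2 = gV G &
      gE H1 `&` gE H2 = fset0 /\ gE H1 `|` gE H2 = gE G].

Lemma gluedC G H1 H2 X : glued G H1 H2 X -> glued G H2 H1 X.
Proof.
by move=> [s1 s2 VI VU [EI EU]]; split; rewrite 1?fsetIC 1?fsetUC //; split=> //;
  rewrite 1?fsetIC 1?fsetUC.
Qed.

Definition loopless (G : graph) : Prop := forall e, e \in gE G -> ~~ is_loop G e.

Lemma nonseparable_loopless2 G x y : nonseparable G -> x \in gV G -> y \in gV G ->
  x != y -> loopless G.
Proof.
move=> [_ [_ [//|[cV _]]]] xV yV xy.
have : (#|` [fset x; y]| <= #|` gV G|)%N.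
  by apply: fsubset_leq_card; apply/fsubsetP => z; rewrite !inE => /orP[]/eqP->.
by rewrite cardfs2 xy cV.
Qed.

Lemma nonseparable_looplessE G e f : nonseparable G -> e \in gE G -> f \in gE G ->
  e != f -> loopless G.
Proof.
move=> [_ [_ [//|[_ cE]]]] eE fE ef.
have : (#|` [fset e; f]| <= #|` gE G|)%N.
  by apply: fsubset_leq_card; apply/fsubsetP => z; rewrite !inE => /orP[]/eqP->.
by rewrite cardfs2 ef cE.
Qed.

Lemma subgraph_ends H G e : subgraph H G -> e \in gE H ->
  (gends G e).1 \in gV H /\ (gends G e).2 \in gV H.
Proof. by move=> [w _ _ <-]; apply: w. Qed.

Lemma mem_cap (A B X : {fset nat}) z : A `&` B = X ->
  z \in A -> z \in B -> z \in X.
Proof. by move=> <- zA zB; rewrite inE zA. Qed.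

Lemma glued_edge G H1 H2 X e : glued G H1 H2 X -> e \in gE G ->
  (e \in gE H1 /\ ((gends G e).1 \in gV H1 /\ (gends G e).2 \in gV H1)) \/
  (e \in gE H2 /\ ((gends G e).1 \in gV H2 /\ (gends G e).2 \in gV H2)).
Proof.
move=> [s1 s2 _ _ [_ EU]]; rewrite -EU inE => /orP[eE|eE]; [left|right];
  split=> //; exact: subgraph_ends eE.
Qed.

(* Away from v, an edge of G has both ends in H1 or both ends outside H1. *)
Lemma glued_avoid G H1 H2 v (A : {fset nat}) a b : glued G H1 H2 [fset v] ->
  A `<=` gE G ->
  (forall e, e \in A -> (gends G e).1 != v /\ (gends G e).2 != v) ->
  a \in gV H1 -> b \in gV H2 -> b != v -> ~ conn (gends G) A a b.
Proof.
move=> gl /fsubsetP sA av aV bV bv ab; have [_ _ VI _ _] := gl.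
have out z : z \in gV H2 -> z != v -> z \notin gV H1.
  by move=> z2 zv; apply: contra zv => z1; have := mem_cap VI z1 z2; rewrite inE.
have : b \in gV H1; last by apply/negP/out.
apply: (conn_closed (P := fun z => z \in gV H1) _ ab aV) => e eA.
have [v1 v2] := av e eA; case: (glued_edge gl (sA e eA)) => -[_ [e1 e2]] //.
by rewrite (negbTE (out _ e1 v1)) (negbTE (out _ e2 v2)).
Qed.

Lemma glued_cut G H1 H2 v a b : connected G -> glued G H1 H2 [fset v] ->
  a \in gV H1 -> b \in gV H2 -> a != v -> b != v -> is_cut_vertex G v.
Proof.
move=> cG gl aV bV av bv; have [[_ s1 _ _] [_ s2 _ _] VI VU _] := gl.
apply/(cut_vertexP v cG); split.
  by apply: (fsubsetP s1); move/fsetP/(_ v): VI; rewrite !inE eqxx => /andP[].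
exists a, b; split=> //; [exact: (fsubsetP s1)|exact: (fsubsetP s2)|].
apply: glued_avoid gl _ _ aV bV bv.
  by apply/fsubsetP => e; rewrite del_vertexE => /and3P[].
by move=> e; rewrite del_vertexE => /and3P[].
Qed.

Lemma connected_incident G e x : connected G -> e \in gE G -> x \in gV G ->
  exists2 f, f \in gE G & x = (gends G f).1 \/ x = (gends G f).2.
Proof.
move=> [wG [_ cG]] eE xV; apply: contrapT => nex.
have e1 : (gends G e).1 = x.
  apply: (conn_closed (P := fun z => z = x) _ (cG x _ xV (wG e eE).1)) => // f fE.
  by split=> h; exfalso; apply: nex; exists f => //; [left|right].
by apply: nex; exists e => //; left.
Qed.

(** A connected graph with an edge has no isolated vertex, so its edges determine its vertices. *)
Lemma subgraph_side G H1 H2 v B e : glued G H1 H2 [fset v] -> connected B ->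
  subgraph B G -> e \in gE B -> gE B `<=` gE H1 -> subgraph B H1.
Proof.
move=> [s1 _ _ _ _] cB [wB _ _ eB] eE sE; split=> //; last by case: s1 => _ _ _ ->.
apply/fsubsetP => x xV; have [f fE xf] := connected_incident cB eE xV.
have [e1 e2] := subgraph_ends s1 (fsubsetP sE f fE).
by case: xf => ->; rewrite eB.
Qed.

Lemma nonloop_end G H e v : subgraph H G -> e \in gE H -> ~~ is_loop G e ->
  exists a, [/\ a \in gV H, a != v & a = (gends G e).1 \/ a = (gends G e).2].
Proof.
move=> s eH; have [e1 e2] := subgraph_ends s eH; rewrite /is_loop => nl.
case: (eqVneq (gends G e).1 v) => h.
  by exists (gends G e).2; rewrite eq_sym -h e2 nl; split=> //; right.
by exists (gends G e).1; split=> //; left.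
Qed.

(** Suppose [B] has an edge on each side. Two distinct edges exclude the single loop, so each has an
    end other than [v]. These ends are separated by [v] if [v] lies in [B], and disconnected in [B]
    if it does not. *)
Lemma nonseparable_side G H1 H2 v B : glued G H1 H2 [fset v] -> nonseparable B ->
  subgraph B G -> gE B != fset0 -> subgraph B H1 \/ subgraph B H2.
Proof.
move=> gl nB sB /fset0Pn[e0 e0B]; have [cB [ncut _]] := nB.
have [s1 s2 VI _ [EI EU]] := gl; have [wB _ EB eB] := sB.
case: (boolP (gE B `<=` gE H1)) => [h|/fsubsetPn[e eE e1]].
  by left; apply: subgraph_side gl cB sB e0B h.
case: (boolP (gE B `<=` gE H2)) => [h|/fsubsetPn[f fE f2]].
  by right; apply: subgraph_side (gluedC gl) cB sB e0B h.
have e2 : e \in gE H2.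
  by move: (fsubsetP EB e eE); rewrite -EU inE (negbTE e1).
have f1 : f \in gE H1.
  by move: (fsubsetP EB f fE); rewrite -EU inE (negbTE f2) orbF.
have ef : e != f by apply: contraNneq e1 => ->.
have lB : loopless B by apply: nonseparable_looplessE nB eE fE ef.
have lG g : g \in gE B -> ~~ is_loop G g by move=> /lB; rewrite /is_loop eB.
have [a [aV av ae]] := nonloop_end v s1 f1 (lG f fE).
have [b [bV bv be]] := nonloop_end v s2 e2 (lG e eE).
have aB : a \in gV B by have [] := wB f fE; rewrite eB; case: ae => ->.
have bB : b \in gV B by have [] := wB e eE; rewrite eB; case: be => ->.
exfalso; case: (boolP (v \in gV B)) => vB.
  apply: (ncut v); apply/(cut_vertexP v cB); split=> //.
  exists a, b; split=> //; rewrite eB; apply: glued_avoid gl _ _ aV bV bv.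
    by apply/fsubsetP => g; rewrite del_vertexE => /and3P[/(fsubsetP EB)].
  by move=> g; rewrite del_vertexE eB => /and3P[].
apply: (glued_avoid gl EB _ aV bV bv); last first.
  by case: cB => _ [_ /(_ a b aB bB)]; rewrite eB.
move=> g /wB; rewrite eB => -[g1 g2].
by split; apply: contraNneq vB => <-.
Qed.

Lemma subgraph_trans H G K : subgraph H G -> subgraph G K -> subgraph H K.
Proof.
move=> [w sV sE e] [_ sV' sE' e']; split; rewrite ?e //.
  exact: fsubset_trans sV'.
exact: fsubset_trans sE'.
Qed.

Lemma subgraph_anti H G : subgraph H G -> subgraph G H -> H = G.
Proof.
move=> [_ sV sE e] [_ sV' sE' _]; case: H G e sV sE sV' sE' => V E h [V' E' h'] /= -> a b c d.
by congr Graph; apply/eqP; rewrite eqEfsubset ?a ?b.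
Qed.

(** A nonseparable graph containing [B] shares an edge with it and stays on the same side, so
    maximality can be tested there. Edgeless blocks are excluded because a side reduced to [v] is
    its own block but need not be a block of [G]. *)
Lemma block_glued G H1 H2 v B : glued G H1 H2 [fset v] -> gE B != fset0 ->
  is_block G B <-> is_block H1 B \/ is_block H2 B.
Proof.
move=> gl E0; have [s1 s2 _ _ [EI _]] := gl.
have lift H : subgraph H G -> subgraph B H -> is_block G B ->
    is_block H B.
  move=> sH sBH [_ nB maxB]; split=> // C sC nC sBC; apply: maxB => //.
  exact: subgraph_trans sH.
have lower K1 K2 : glued G K1 K2 [fset v] -> is_block K1 B -> is_block G B.
  move=> gl' [sB nB maxB]; have [t1 t2 _ _ [EI' _]] := gl'.
  split=> //; first exact: subgraph_trans t1.
  move=> C sC nC sBC; have /fset0Pn[e eB] := E0.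
  have eC : e \in gE C by case: sBC => _ _ /fsubsetP s _; apply: s.
  have C0 : gE C != fset0 by apply/fset0Pn; exists e.
  case: (nonseparable_side gl' nC sC C0) => [|[_ _ /fsubsetP sC2 _]].
    by move=> sC1; apply: maxB.
  have [_ _ /fsubsetP sB1 _] := sB.
  by have := mem_cap EI' (sB1 e eB) (sC2 e eC); rewrite inE.
split=> [bB|[|]]; last 2 first.
- exact: lower gl.
- exact: lower (gluedC gl).
have [sB nB _] := bB.
by case: (nonseparable_side gl nB sB E0) => s; [left|right]; apply: lift.
Qed.

Definition blocks (G : graph) : {fset {fset nat} * {fset nat}} :=
  [fset p in fsetM (fpowerset (gV G)) (fpowerset (gE G)) |
        `[< p.2 != fset0 /\ is_block G (Graph p.1 p.2 (gends G)) >]].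

Lemma blocksP G p : reflect (p.2 != fset0 /\ is_block G (Graph p.1 p.2 (gends G)))
  (p \in blocks G).
Proof.
rewrite !inE !fpowersetE; apply: (iffP andP) => [[_ /asboolP]//|h].
by split; [case: h => _ [[_ /= -> -> _]]|apply/asboolP].
Qed.

Lemma nblocks_glued G H1 H2 v : glued G H1 H2 [fset v] ->
  nblocks G = (nblocks H1 + nblocks H2)%N.
Proof.
move=> gl; have [[_ _ _ e1] [_ _ _ e2] _ _ [EI _]] := gl.
have -> : nblocks G = #|` blocks H1 `|` blocks H2|.
  congr #|` _|; apply/fsetP => p; rewrite inE.
  have bg := @block_glued _ _ _ _ (Graph p.1 p.2 (gends G)) gl.
  apply/blocksP/orP.
    move=> [p0 /(bg p0)[b|b]]; [left|right]; apply/blocksP;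
    by rewrite ?e1 ?e2.
  move=> [] /blocksP[p0 b]; split=> //; apply/(bg p0).
    by left; rewrite -e1.
  by right; rewrite -e2.
have := cardfsUI (blocks H1) (blocks H2).
rewrite (_ : _ `&` _ = fset0) ?cardfs0 ?addn0 //; apply/fsetP => p.
rewrite [in RHS]inE inE; apply/negP => /andP[/blocksP[/fset0Pn[e ep] b1] /blocksP[_ b2]].
move: b1 b2 => [[_ _ /= /fsubsetP s1 _] _ _] [[_ _ /= /fsubsetP s2 _] _ _].
by have := mem_cap EI (s1 e ep) (s2 e ep); rewrite inE.
Qed.

Lemma nonseparable_block G : nonseparable G -> is_block G G.
Proof.
move=> nG; have [[wG _] _] := nG; split=> // B sB _ sG.
exact: subgraph_anti.
Qed.

Lemma nblocks_nonseparable G : nonseparable G -> gE G != fset0 -> nblocks G = 1%N.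
Proof.
move=> nG E0; rewrite -(cardfs1 (gV G, gE G)); congr #|` _|.
apply/fsetP => p; rewrite [in RHS]inE; apply/blocksP/eqP => [[p0 [sp np maxp]]|->].
  have [[wG _] _] := nG; case: p p0 sp np maxp => V E /= E1 sp np maxp.
  by rewrite (maxp G).
by split=> //=; have := nonseparable_block nG; case: (G).
Qed.

(** * Separations *)

Lemma nonseparable_avoid G w x y : nonseparable G -> w \in gV G ->
  x \in gV G -> y \in gV G -> x != w -> y != w ->
  conn (gends G) (gE (del_vertex G w)) x y.
Proof.
move=> [cG [ncut _]] wV xV yV xw yw; apply: contrapT => nxy; apply: (ncut w).
by apply/(cut_vertexP w cG); split=> //; exists x, y.
Qed.

Lemma add_edge_connect (G : graph) u v :
  conn (gends (add_edge G u v)) [fset fresh (gE G)] u v.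
Proof.
have := @conn_edge (gends (add_edge G u v)) [fset fresh (gE G)] (fresh (gE G)) (fset11 _).
by rewrite /= eqxx.
Qed.

Lemma loopless_add G u v : loopless G -> u != v -> loopless (add_edge G u v).
Proof.
move=> lG uv e; rewrite /= !inE /is_loop /=; case: eqP => //= _; exact: lG.
Qed.

(** For (d), where it passes from G2 + u1u2 to G2 + 2u1u2. *)
Lemma nonseparable_parallel G u v : nonseparable G -> u \in gV G -> v \in gV G ->
  u != v -> nonseparable (add_edge G u v).
Proof.
move=> nG uV vV uv; have [cG [ncut _]] := nG; have [wG [V0 cGG]] := cG.
have ext A x y : A `<=` gE G ->
    conn (gends G) A x y -> conn (gends (add_edge G u v)) A x y.
  by move=> /fsubsetP sA; apply: (iffRL (conn_ext _ _ _)) => e /sA /add_endsE.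
have cH : connected (add_edge G u v).
  split; first exact: wf_add.
  split=> // x y xV yV; apply: conn_mono (ext _ _ _ (fsubset_refl _) (cGG x y xV yV)).
  exact: fsubsetU1.
split=> //; split; last first.
  by left; apply: loopless_add => //; apply: nonseparable_loopless2 nG uV vV uv.
move=> w /(cut_vertexP w cH)[wV [x [y [xV yV xw yw]]]]; apply.
have := nonseparable_avoid nG wV xV yV xw yw.
set A := gE (del_vertex G w) => /(ext A x y) h.
have sA : A `<=` gE G by apply/fsubsetP => e; rewrite del_vertexE => /and3P[].
apply: conn_mono (h sA); apply/fsubsetP => e eA.
have eG := fsubsetP sA e eA; move: eA; rewrite !del_vertexE => /and3P[_ e1 e2].
by rewrite (add_endsE _ _ eG) e1 e2 /= !inE eG orbT.
Qed.

(* Collapsing the other side of a 2-separation onto one of u1, u2 distinct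
   from w is a homomorphism from G - w to (G1 + u1u2) - w. *)
Lemma nonseparable_add G G1 G2 u1 u2 : nonseparable G ->
  glued G G1 G2 [fset u1; u2] -> u1 != u2 -> connected (add_edge G1 u1 u2) ->
  nonseparable (add_edge G1 u1 u2).
Proof.
move=> nG gl u12 cH; have [cG [ncut _]] := nG.
have [[w1 /fsubsetP sV1 /fsubsetP sE1 e1] _ VI _ _] := gl.
have [u1V u2V] : u1 \in gV G1 /\ u2 \in gV G1.
  by split; [move/fsetP/(_ u1): VI|move/fsetP/(_ u2): VI];
    rewrite !inE eqxx ?orbT => /andP[].
split=> //; split; last first.
  left; apply: loopless_add => // e eE; rewrite /is_loop e1.
  exact: (nonseparable_loopless2 nG (sV1 _ u1V) (sV1 _ u2V) u12 (sE1 _ eE)).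
move=> w /(cut_vertexP w cH)[wV [x [y [xV yV xw yw]]]]; apply.
have := nonseparable_avoid nG (sV1 w wV) (sV1 x xV) (sV1 y yV) xw yw.
pose t := if w == u1 then u2 else u1.
set H := add_edge G1 u1 u2; set A := gE (del_vertex H w).
have conn12 p q : p \in [fset u1; u2] -> q \in [fset u1; u2] -> p != w -> q != w ->
    conn (gends H) A p q.
  have h : u1 != w -> u2 != w -> conn (gends H) A u1 u2.
    move=> n1 n2; apply: conn_mono (add_edge_connect G1 u1 u2).
    by rewrite fsub1set del_vertexE /= eqxx /= !inE eqxx /= n1 n2.
  rewrite !inE => /orP[]/eqP-> /orP[]/eqP-> pw qw; try exact: conn_refl.
    exact: h.
  exact/conn_sym/h.
have tP : t \in [fset u1; u2] /\ t != w.
  rewrite /t !inE; case: (eqVneq w u1) => [->|]; rewrite ?eqxx ?orbT //.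
    by rewrite eq_sym.
  by rewrite eq_sym.
have out z : z \in gV G2 -> z != w -> retract (gV G1) t z \in [fset u1; u2] /\
    retract (gV G1) t z != w.
  move=> z2 zw; rewrite /retract; case: ifP => // z1.
  by split=> //; apply: mem_cap VI z1 z2.
rewrite -{2}(retract_in t xV) -{2}(retract_in t yV).
apply: conn_map; first exact: conn_equiv.
move=> e; rewrite del_vertexE => /and3P[eG n1 n2].
case: (glued_edge gl eG) => -[eE [m1 m2]].
  rewrite !retract_in //.
  have ee : gends H e = gends G e by rewrite (add_endsE _ _ eE) e1.
  rewrite -!ee; apply: conn_edge; rewrite del_vertexE ee n1 n2 /= !inE eE.
  by rewrite orbT.
have [p1 p2] := out _ m1 n1; have [q1 q2] := out _ m2 n2.
exact: conn12.
Qed.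

(** Moving [e] together with its end [u1] to the side of [H2] produces a separation of [G] at the
    pair [v], [u1] with [H1] as its first side, so the lemma on such pairs applies. *)
Lemma nonseparable_add_bridge G H1 H2 e v u1 u2 : nonseparable G ->
  glued (del_edge G e) H1 H2 [fset v] -> e \in gE G ->
  gends G e = (u1, u2) \/ gends G e = (u2, u1) ->
  u1 \in gV H1 -> u2 \in gV H2 -> u1 != v -> connected (add_edge H1 v u1) ->
  nonseparable (add_edge H1 v u1).
Proof.
move=> nG gl eE ee u1V u2V u1v cH.
have [[w1 sV1 sE1 e1] [w2 sV2 sE2 e2] VI VU [EI EU]] := gl.
have [[wG _] _] := nG.
apply: (@nonseparable_add G H1 (Graph (u1 |` gV H2) (e |` gE H2) (gends G)) v u1) => //.
  have e1' : e \notin gE H1.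
    by apply/negP => /(fsubsetP sE1); rewrite /= !inE eqxx.
  split.
  - split=> //; apply: fsubset_trans sE1 _; exact: fsubsetDl.
  - split=> //.
    + move=> f /=; rewrite !inE => /orP[/eqP->|/w2]; last first.
        by rewrite e2 /= => -[-> ->]; rewrite !orbT.
      by case: ee => -> /=; rewrite eqxx u2V orbT.
    + by rewrite fsubUset fsub1set sV2 (fsubsetP sV1).
    + rewrite fsubUset fsub1set eE; apply: fsubset_trans sE2 _; exact: fsubsetDl.
  - apply/fsetP => z; move/fsetP/(_ z): VI; rewrite /= !inE.
    by case: (eqVneq z u1) => [->|] /=; rewrite ?u1V ?orbT // orbF.
  - by rewrite /= fsetUCA VU; apply/fsetUidPr; rewrite fsub1set (fsubsetP sV1).
  split=> /=; last by rewrite fsetUCA EU fsetD1K.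
  apply/fsetP => z; move/fsetP/(_ z): EI; rewrite !inE.
  by case: (eqVneq z e) => [->|] //=; rewrite (negbTE e1').
by rewrite eq_sym.
Qed.

Lemma glued_connected G H1 H2 v : connected G -> glued G H1 H2 [fset v] -> connected H1.
Proof.
move=> [wG [_ cG]] [[w1 sV1 sE1 e1] [w2 _ _ e2] VI VU [_ EU]]; split=> //; split.
  by apply/fset0Pn; exists v; move/fsetP/(_ v): VI; rewrite !inE eqxx => /andP[].
have {}w1 : ends_in (gends G) (gV H1) (gE H1) by rewrite -e1.
have {}w2 : ends_in (gends G) (gV H2) (gE H2) by rewrite -e2.
move=> x y xV yV; rewrite e1.
have := cG x y (fsubsetP sV1 x xV) (fsubsetP sV1 y yV); rewrite -EU.
by move/(conn_glue1 VI w1 w2 xV yV).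
Qed.

Lemma connected_edge G x y : connected G -> x \in gV G -> y \in gV G -> x != y ->
  gE G != fset0.
Proof.
move=> [_ [_ cG]] xV yV; apply: contraNneq => E0; apply/eqP.
by have := cG x y xV yV; rewrite E0 => /conn0.
Qed.

(** * Splitting a separable graph into two graphs with fewer edges *)

Definition splits (G H1 H2 : graph) (v : nat) : Prop :=
  glued G H1 H2 [fset v] /\ gE H1 != fset0 /\ gE H2 != fset0.

Lemma cut_split G v : connected G -> is_cut_vertex G v ->
  exists H1 H2, splits G H1 H2 v.
Proof.
move=> cG /(cut_vertexP v cG)[vV [x [y [xV yV xv yv nxy]]]]; have [wG _] := cG.
pose A := gE (del_vertex G v).
(* Side 1 is [v] with the component of [x] in G - v, side 2 is [v] with all the rest; loops at [v]
   go to side 1. *)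
pose V1 := [fset z in gV G | (z == v) || ((z != v) && linked (gends G) A x z)].
pose V2 := v |` (gV G `\` V1).
pose E1 := [fset e in gE G | ((gends G e).1 \in V1) && ((gends G e).2 \in V1)].
pose E2 := gE G `\` E1.
have side e : e \in gE G -> e \notin E1 -> (gends G e).1 \in V2 /\ (gends G e).2 \in V2.
  move=> eE; have [g1 g2] := wG e eE.
  have V1v : v \in V1 by rewrite !inE vV eqxx.
  have V2E z : z \in gV G -> (z \in V2) = (z == v) || (z \notin V1).
    by move=> zV; rewrite /V2 in_fset1U in_fsetD zV andbT.
  have -> : (e \in E1) = ((gends G e).1 \in V1) && ((gends G e).2 \in V1).
    by rewrite in_fset /= inE /= eE.
  rewrite !V2E // negb_and.
  case: (eqVneq (gends G e).1 v) => [->|v1]; first by rewrite V1v /= => ->; rewrite orbT.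
  case: (eqVneq (gends G e).2 v) => [->|v2]; first by rewrite V1v /= orbF => ->.
  suff -> : ((gends G e).1 \in V1) = ((gends G e).2 \in V1) by case: (_ \in V1).
  rewrite !inE g1 g2 v1 v2 (negbTE v1) (negbTE v2) /=.
  have eA : e \in A by rewrite del_vertexE eE v1 v2.
  have ee := conn_edge (gends G) eA.
  by apply: asbool_equiv_eq; split=> h; apply: (conn_trans h) => //; apply: conn_sym.
have gl : glued G (Graph V1 E1 (gends G)) (Graph V2 E2 (gends G)) [fset v].
  split=> /=.
  - split=> //= [e||]; last exact: fset_sub.
      by rewrite !inE => /andP[_ /andP[]].
    exact: fset_sub.
  - split=> //= [e||]; last exact: fsubsetDl.
      by rewrite [e \in _]in_fsetD => /andP[e1 eE]; apply: side.
    by rewrite fsubUset fsub1set vV fsubsetDl.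
  - apply/fsetP => z; rewrite !inE; case: (eqVneq z v) => [->|] /=; first by rewrite vV.
    by case: (z \in gV G); case: linked.
  - apply/fsetP => z; rewrite !inE; case: (eqVneq z v) => [->|] /=; first by rewrite vV.
    by case: (z \in gV G); case: linked.
  split; apply/fsetP => z.
    by rewrite in_fsetI in_fsetD in_fset0; case: (z \in E1).
  rewrite in_fsetU in_fsetD; case: (boolP (z \in E1)) => //= zE.
  by symmetry; apply: (fsubsetP (fset_sub _ _) _ zE).
exists (Graph V1 E1 (gends G)), (Graph V2 E2 (gends G)); split=> //.
have c1 := glued_connected cG gl; have c2 := glued_connected cG (gluedC gl).
have x1 : x \in V1.
  by rewrite !inE xV xv /=; apply/orP; right; apply/linkedP/conn_refl.
have v1 : v \in V1 by rewrite !inE vV eqxx.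
have y2 : y \in V2.
  rewrite /V2 in_fset1U in_fsetD yV andbT (negbTE yv) !inE yV yv (negbTE yv) /=.
  exact/linkedP.
(* Each side is connected and has a vertex besides [v], which forces an edge. *)
split; first exact: connected_edge c1 x1 v1 xv.
exact: connected_edge c2 y2 (fset1U1 _ _) yv.
Qed.

(** A loop splits off at its end even when that end is not a cut vertex. By connectedness, the rest
    is edgeless only if [G] is a single loop. *)
Lemma loop_split G e : connected G -> e \in gE G -> is_loop G e ->
  ~ (#|` gV G| = 1%N /\ #|` gE G| = 1%N) ->
  exists H1 H2, splits G H1 H2 (gends G e).1.
Proof.
move=> cG eE le n11; have [wG [V0 cGG]] := cG; set v := (gends G e).1.
have e2 : (gends G e).2 = v by move/eqP: le.
have vV : v \in gV G by have [] := wG e eE.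
exists (Graph [fset v] [fset e] (gends G)), (Graph (gV G) (gE G `\ e) (gends G)).
split; last first.
  split=> /=; first by apply/fset0Pn; exists e; rewrite fset11.
  apply/negP => /eqP E0; apply: n11.
  have EE : gE G = [fset e] by rewrite -(fsetD1K eE) E0 fsetU0.
  rewrite EE cardfs1; split=> //.
  rewrite (_ : gV G = [fset v]) ?cardfs1 //.
  apply/fsetP => z; rewrite !inE; apply/idP/eqP => [zV|->//].
  apply: (conn_closed (P := fun z => z = v) _ (cGG v z vV zV)) => // f.
  by rewrite EE inE => /eqP->; rewrite e2.
split=> /=.
- split=> //= [f||]; rewrite ?fsub1set //.
  by rewrite !inE => /eqP->; rewrite e2 eqxx.
- by split=> //=; [move=> f /=; rewrite !inE => /andP[_ /wG]|exact: fsubsetDl].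
- by apply/fsetIidPl; rewrite fsub1set.
- by apply/fsetUidPr; rewrite fsub1set.
split; last exact: fsetD1K.
by apply/fsetP => f; rewrite !inE; case: eqP.
Qed.

Lemma separable_split G : separable G -> exists v H1 H2, splits G H1 H2 v.
Proof.
move=> [cG nG]; apply: contrapT => nex; apply: nG; split=> //; split.
  by move=> v /(cut_split cG)[H1 [H2 s]]; apply: nex; exists v, H1, H2.
case: (pselect (#|` gV G| = 1%N /\ #|` gE G| = 1%N)) => [|n11]; first by right.
left=> e eE; apply/negP => le; apply: nex.
by have [H1 [H2 s]] := loop_split cG eE le n11; exists (gends G e).1, H1, H2.
Qed.

(** * The signed flow polynomial *)

(** Parity of [pG], the negation accounting for the final -1. As a boolean, it reduces every sign
    identity to a finite case check. *)
Definition psign (G : graph) : bool :=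
  odd #|` gE G| (+) odd #|` gV G| (+) ~~ odd (nblocks G).

Lemma QpolyE (R : realType) (G : graph) (l : R) :
  Qpoly G l = ((-1) ^+ psign G * flowpoly G l)%R.
Proof.
rewrite /Qpoly /pG /psign; congr (_ * _)%R.
rewrite -!oddD -[~~ odd _]/(odd (nblocks G).+1) -oddD signr_odd.
rewrite !expfzDr ?oppr_eq0 ?oner_eq0 // -!exprnN -!exprnP !invr_sign.
by rewrite -!exprD addn1 addnS.
Qed.

Lemma Qpoly_mul (R : realType) (l : R) G H K : psign G = psign H (+) psign K ->
  ((-1) ^+ psign G * (flowpoly H l * flowpoly K l) = Qpoly H l * Qpoly K l)%R.
Proof. by move=> e; rewrite !QpolyE e signr_addb mulrACA. Qed.

Lemma Qpoly_mulN (R : realType) (l : R) G H K : psign G = ~~ (psign H (+) psign K) ->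
  ((-1) ^+ psign G * (flowpoly H l * flowpoly K l) = - (Qpoly H l * Qpoly K l))%R.
Proof. by move=> e; rewrite !QpolyE e signrN signr_addb mulNr mulrACA. Qed.

Lemma flowpoly_glued1 (R : realType) (l : R) G H1 H2 v : glued G H1 H2 [fset v] ->
  flowpoly G l = (flowpoly H1 l * flowpoly H2 l)%R.
Proof.
move=> [[w1 _ _ e1] [w2 _ _ e2] VI VU [EI EU]]; rewrite !flowpolyE -VU -EU e1 e2.
by apply: (flow_glue1 _ VI EI) ; [rewrite -e1|rewrite -e2].
Qed.

Lemma flowpoly_glued2 (R : realType) (l : R) G H1 H2 a b : glued G H1 H2 [fset a; b] ->
  a != b ->
  flowpoly G l = (flowpoly H1 l * flowpoly H2 l +
    (l - 1) * gpflow l H1 a b * gpflow l H2 a b)%R.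
Proof.
move=> [[w1 _ _ e1] [w2 _ _ e2] VI VU [EI EU]] ab.
rewrite /gpflow !flowpolyE -VU -EU e1 e2.
by apply: (flow_glue2 _ VI ab EI) ; [rewrite -e1|rewrite -e2].
Qed.

Lemma gpflow_glued1 (R : realType) (l : R) G H1 H2 v x y : glued G H1 H2 [fset v] ->
  x \in gV H1 -> y \in gV H2 ->
  gpflow l G x y = (gpflow l H1 x v * gpflow l H2 v y)%R.
Proof.
move=> [[w1 _ _ e1] [w2 _ _ e2] VI VU [EI EU]] x1 y2.
rewrite /gpflow -VU -EU e1 e2.
by apply: (pflow_glue1 _ VI EI _ _ x1 y2) ; [rewrite -e1|rewrite -e2].
Qed.

Lemma gpflowC (R : realType) (l : R) G x y : gpflow l G x y = gpflow l G y x.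
Proof.
apply: eq_sum_fpowerset => A _; congr ((nat_of_bool _)%:R * _)%R.
by apply: asbool_equiv_eq; split; apply: conn_sym.
Qed.

Lemma odd_glued G H1 H2 (X : {fset nat}) : glued G H1 H2 X ->
  (odd #|` gE G| = odd #|` gE H1| (+) odd #|` gE H2|) *
  (odd #|` gV G| = odd #|` gV H1| (+) odd #|` gV H2| (+) odd #|` X|).
Proof.
move=> [_ _ VI VU [EI EU]]; split; first by rewrite -EU (card_disjointU EI) oddD.
have := congr1 odd (card_glue VI); rewrite VU !oddD => <-.
by rewrite -addbA addbb addbF.
Qed.

(** The exponents [pG] of the sides add up to that of [G] minus 2: the shared vertex and the
    constant -1 are each counted twice. *)
Lemma Qpoly_glued1 (R : realType) (l : R) G H1 H2 v : glued G H1 H2 [fset v] ->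
  Qpoly G l = (Qpoly H1 l * Qpoly H2 l)%R.
Proof.
move=> gl; rewrite QpolyE (flowpoly_glued1 l gl); apply: Qpoly_mul.
rewrite /psign !(odd_glued gl) (nblocks_glued gl) oddD cardfs1 /=.
by do 6!case: (odd _).
Qed.

Lemma card_E_add G u v : #|` gE (add_edge G u v)| = (#|` gE G|).+1.
Proof. by rewrite /= cardfsU1 fresh_notin. Qed.

Lemma nblocks_edgeless G : gE G = fset0 -> nblocks G = 0%N.
Proof.
move=> E0; rewrite -(cardfs0 ({fset nat} * {fset nat})%type); congr #|` _|.
apply/fsetP => p; rewrite [in RHS]inE; apply/negP => /blocksP[p0 [[_ _ /=]]].
by rewrite E0 fsubset0 (negbTE p0).
Qed.

Lemma Qpoly_edgeless (R : realType) (l : R) G : connected G -> gE G = fset0 ->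
  Qpoly G l = 1%R.
Proof.
move=> cG E0; have c1 := comps_connected cG.
have V1 : #|` gV G| = 1%N by rewrite -c1 /comps E0 ncomp0.
rewrite QpolyE /psign E0 V1 nblocks_edgeless // cardfs0 /= expr0 mul1r flowpolyE /flow E0.
by rewrite fpowerset0 big_seq_fset1 /wt cardfs0 ncomp0 add0n !subnn !expr0 mulr1.
Qed.

Lemma glued_card_E G H1 H2 v : splits G H1 H2 v ->
  (#|` gE H1| < #|` gE G|)%N /\ (#|` gE H2| < #|` gE G|)%N.
Proof.
move=> [[_ _ _ _ [EI EU]] [h1 h2]]; rewrite -EU (card_disjointU EI).
move: h1 h2; rewrite -!cardfs_gt0 => h1 h2.
by split; [rewrite -addn1 leq_add2l|rewrite -add1n leq_add2r].
Qed.

(** The family is closed under blocks, but the sides of a split need not belong to it. The induction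
    therefore ranges over all connected graphs, and positivity is assumed on blocks only. *)
Lemma Qpoly_blocks_gt0 (R : realType) (l : R) G : connected G ->
  (forall B, is_block G B -> gE B != fset0 -> 0 < Qpoly B l)%R -> (0 < Qpoly G l)%R.
Proof.
elim/ltn_ind: {G}#|` gE G| {-2}G (erefl #|` gE G|) => n IH G En cG posB.
case: (eqVneq (gE G) fset0) => [E0|E0]; first by rewrite Qpoly_edgeless.
case: (pselect (nonseparable G)) => [nG|sG].
  by apply: posB => //; apply: nonseparable_block.
have [v [H1 [H2 s]]] := separable_split (conj cG sG); have [gl _] := s.
have [c1 c2] := glued_card_E s.
rewrite (Qpoly_glued1 l gl) mulr_gt0 //.
  apply: (IH #|` gE H1|) => //; rewrite -?En //; first exact: glued_connected gl.
  by move=> B bB B0; apply: posB => //; apply/(block_glued gl B0); left.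
apply: (IH #|` gE H2|) => //; rewrite -?En //; first exact: glued_connected (gluedC gl).
by move=> B bB B0; apply: posB => //; apply/(block_glued gl B0); right.
Qed.

(** A block containing all edges would contain all vertices too, hence be [G] itself. *)
Lemma block_card_E G B : connected G -> ~ nonseparable G -> is_block G B ->
  gE B != fset0 -> (#|` gE B| < #|` gE G|)%N.
Proof.
move=> cG sG [sB nB _] /fset0Pn[e eB]; have [_ sV sE eE] := sB.
rewrite ltn_neqAle fsubset_leq_card // andbT; apply/negP => /eqP /fsubset_cardP r.
have {r}/fsetP EE : gE B =i gE G by apply/r.
apply: sG; suff -> : G = B by [].
apply: subgraph_anti (sB); have [wG _] := cG; split; rewrite ?EE //.
apply/fsubsetP => x xV; have eG := fsubsetP sE e eB.
have [f fE xf] := connected_incident cG eG xV; rewrite -EE in fE.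
by have [f1 f2] := subgraph_ends sB fE; case: xf => ->.
Qed.

(** * Nondegeneracy of the separations of a nonseparable graph *)

Lemma comps_gt0 G : gV G != fset0 -> (0 < comps G)%N.
Proof.
move=> /fset0Pn[x xV]; have [m [mV xm mmin]] :=
  @least_rep (gV G) (conn (gends G) (gE G)) x (conn_refl _ _ _) xV.
rewrite /comps /ncomp cardfs_gt0; apply/fset0Pn; exists m.
rewrite !inE mV; apply/asboolP => y yV my; apply: mmin => //.
exact: conn_trans my.
Qed.

(** If [v] were an end of [e], G - v and (G - e) - v would coincide, and [v] would be a cut vertex
    of [G]. *)
Lemma cut_del_end G e v : nonseparable G -> is_cut_vertex (del_edge G e) v ->
  (gends G e).1 != v /\ (gends G e).2 != v.
Proof.
move=> [cG [ncut _]] [vV lt]; apply/andP; rewrite -negb_or; apply/negP => ev.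
apply: (ncut v); split=> //; rewrite (comps_connected cG).
have -> : comps (del_vertex G v) = comps (del_vertex (del_edge G e) v).
  rewrite /comps /=; congr (ncomp _ _ _); apply/fsetP => f; rewrite !inE.
  by case: (eqVneq f e) => [->|] //=; case/orP: ev => ->; rewrite ?andbF.
by apply: leq_ltn_trans lt; apply: comps_gt0; case: cG => _ [].
Qed.

Lemma add_edge_neq0 G u v : gE (add_edge G u v) != fset0.
Proof. by apply/fset0Pn; exists (fresh (gE G)); apply: fset1U1. Qed.

(** If [H2] had no edge, [e] would be the only edge at [u2], and deleting [u1] would cut [u2] off
    from [v]. An edge on each side is what makes H1 + vu1 and H2 + vu2 smaller than [G]. *)
Lemma bridge_side_neq0 G H1 H2 e v u1 u2 : nonseparable G ->
  glued (del_edge G e) H1 H2 [fset v] ->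
  gends G e = (u1, u2) \/ gends G e = (u2, u1) ->
  u1 \in gV H1 -> u2 \in gV H2 -> u1 != v -> u2 != v -> gE H2 != fset0.
Proof.
move=> nG gl ee u1V u2V u1v u2v; apply/negP => /eqP E2.
have [[w1 sV1 sE1 e1] [_ sV2 _ _] VI _ [_ EU]] := gl.
have u21 : u2 \notin gV H1.
  by apply: contra u2v => h; have := mem_cap VI h u2V; rewrite inE.
have u12 : u1 != u2 by apply: contraNneq u21 => <-.
have vV1 : v \in gV H1 by move/fsetP/(_ v): VI; rewrite !inE eqxx => /andP[].
have := nonseparable_avoid nG (fsubsetP sV1 _ u1V) (fsubsetP sV2 _ u2V)
  (fsubsetP sV1 _ vV1).
rewrite eq_sym u12 eq_sym u1v => /(_ isT isT) h.
have : v = u2; last by move/eqP; rewrite eq_sym (negbTE u2v).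
apply: (conn_closed (P := fun z => z = u2) _ h) => // f.
rewrite del_vertexE => /and3P[fE f1 f2].
have fe : f != e.
  by apply/negP => /eqP fe; case: ee f1 f2; rewrite fe => -> /=; rewrite eqxx.
have fH : f \in gE H1 by move: EU; rewrite E2 fsetU0 => ->; rewrite !inE fe.
have [m1 m2] := w1 f fH; rewrite e1 /= in m1 m2.
by split=> x; move: u21; rewrite -x ?m1 ?m2.
Qed.

(** If the two vertices coincided, they would form a cut vertex between the nonloop edges of the two
    sides. *)
Lemma glued2_neq G G1 G2 u1 u2 : nonseparable G -> glued G G1 G2 [fset u1; u2] ->
  gE G1 != fset0 -> gE G2 != fset0 -> u1 != u2.
Proof.
move=> nG gl /fset0Pn[e eE] /fset0Pn[f fE]; apply/negP => /eqP u12.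
have [cG [ncut _]] := nG.
have {}gl : glued G G1 G2 [fset u2] by rewrite -{1}(fsetUid [fset u2]) -{1}u12.
have [s1 s2 VI VU [EI EU]] := gl.
have ef : e != f.
  by apply/negP => /eqP h; rewrite h in eE; have := mem_cap EI eE fE; rewrite inE.
have eG : e \in gE G by rewrite -EU inE eE.
have fG : f \in gE G by rewrite -EU inE fE orbT.
have lG := nonseparable_looplessE nG eG fG ef.
have [a [aV av _]] := nonloop_end u2 s1 eE (lG e eG).
have [b [bV bv _]] := nonloop_end u2 s2 fE (lG f fG).
exact: ncut (glued_cut cG gl aV bV av bv).
Qed.

(** * Identities for Q in the four reductions *)

Lemma psign_nonseparable G : nonseparable G -> gE G != fset0 ->
  psign G = odd #|` gE G| (+) odd #|` gV G|.
Proof. by move=> nG E0; rewrite /psign (nblocks_nonseparable nG E0) addbF. Qed.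

Lemma psign_add G u v : nonseparable (add_edge G u v) ->
  psign (add_edge G u v) = ~~ (odd #|` gE G| (+) odd #|` gV G|).
Proof.
by move=> n; rewrite (psign_nonseparable n (add_edge_neq0 _ _ _)) card_E_add addNb.
Qed.

(** The edge [e] yields one factor l - 1 on the left, the two added edges yield two on the right. *)
Lemma Qpoly_bridge (R : realType) (l : R) G H1 H2 e v u1 u2 : nonseparable G ->
  e \in gE G -> gends G e = (u1, u2) \/ gends G e = (u2, u1) ->
  glued (del_edge G e) H1 H2 [fset v] -> u1 \in gV H1 -> u2 \in gV H2 ->
  nonseparable (add_edge H1 v u1) -> nonseparable (add_edge H2 v u2) ->
  ((l - 1) * Qpoly G l = Qpoly (add_edge H1 v u1) l * Qpoly (add_edge H2 v u2) l)%R.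
Proof.
move=> nG eE ee gl u1V u2V n1 n2; have [[wG _] _] := nG.
have [[w1 _ _ _] [w2 _ _ _] VI _ _] := gl.
have [v1 v2] : v \in gV H1 /\ v \in gV H2.
  by move/fsetP/(_ v): VI; rewrite !inE eqxx => /andP[].
rewrite -(@Qpoly_mul _ l G); last first.
  rewrite !psign_add // psign_nonseparable //; last by apply/fset0Pn; exists e.
  rewrite (cardfsD1 e (gE G)) eE oddD -[gE G `\ e]/(gE (del_edge G e)).
  rewrite -[gV G]/(gV (del_edge G e)) !(odd_glued gl) cardfs1 /=.
  by do 4!case: (odd _).
rewrite !flowpoly_add // QpolyE (flowpoly_del l wG eE).
have -> : gpflow l (del_edge G e) (gends G e).1 (gends G e).2 =
    gpflow l (del_edge G e) u1 u2 by case: ee => -> //=; apply: gpflowC.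
rewrite (gpflow_glued1 l gl u1V u2V) (gpflowC l H1 v u1).
by rewrite mulrCA; congr (_ * _)%R; rewrite -!mulrA; congr (_ * _)%R; rewrite mulrCA.
Qed.

(** All three block numbers are odd. Contraction loses an edge and a vertex and keeps the sign;
    deletion loses only an edge and reverses it, which turns the minus of deletion-contraction into
    a plus. *)
Lemma Qpoly_delete_contract (R : realType) (l : R) G e : nonseparable G ->
  e \in gE G -> odd (nblocks (del_edge G e)) -> odd (nblocks (contract G e)) ->
  Qpoly G l = (Qpoly (contract G e) l + Qpoly (del_edge G e) l)%R.
Proof.
move=> nG eE bd bc; have [[wG _] _] := nG; have [e1 e2] := wG e eE.
have nl : ~~ is_loop G e.
  (* An odd number of blocks gives G - e an edge; then [G] has two edges, hence no loop. *)
  have : gE (del_edge G e) != fset0.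
    by apply: contraTneq bd => /nblocks_edgeless ->.
  move=> /fset0Pn[f]; rewrite /= !inE => /andP[fe fE].
  exact: (nonseparable_looplessE nG fE eE fe).
have := nl; rewrite /is_loop => /negbTE nl'.
have oE := cardfsD1 e (gE G); have oV := cardfsD1 (gends G e).2 (gV G).
rewrite eE in oE; rewrite e2 in oV.
rewrite !QpolyE flowpoly_contract // /psign bd bc /= nl' /= oE oV !oddD /=.
rewrite (nblocks_nonseparable nG); last by apply/fset0Pn; exists e.
move: (flowpoly G l) (flowpoly _ l) => x y.
by case: (odd _) => /=; case: (odd _) => /=; rewrite ?expr0 ?expr1; ring.
Qed.

(** The signs of the two added edges cancel in the last product; in the first one the sign agrees
    with that of [G] because the block numbers have an even sum. *)
Lemma Qpoly_glued2 (R : realType) (l : R) G G1 G2 a b : nonseparable G ->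
  glued G G1 G2 [fset a; b] -> a != b -> gE G1 != fset0 ->
  nonseparable (add_edge G1 a b) -> nonseparable (add_edge G2 a b) ->
  ~~ odd (nblocks G1 + nblocks G2) ->
  ((l - 1) * Qpoly G l = (l - 1) * (Qpoly G1 l * Qpoly G2 l) +
     Qpoly (add_edge G1 a b) l * Qpoly (add_edge G2 a b) l)%R.
Proof.
move=> nG gl ab E1 n1 n2; rewrite oddD => bb; have [s1 s2 VI _ [_ EU]] := gl.
have [w1 _ _ _] := s1; have [w2 _ _ _] := s2.
have E0 : gE G != fset0 by rewrite -EU fsetU_eq0 (negbTE E1).
have [[a1 a2] [b1 b2]] : (a \in gV G1 /\ a \in gV G2) /\ (b \in gV G1 /\ b \in gV G2).
  by split; [move/fsetP/(_ a): VI|move/fsetP/(_ b): VI];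
    rewrite !inE eqxx ?orbT => /andP[].
have p : psign G = odd #|` gE G1| (+) odd #|` gE G2| (+) (odd #|` gV G1| (+) odd #|` gV G2|).
  by rewrite psign_nonseparable // !(odd_glued gl) cardfs2 ab /= addbF.
rewrite -(@Qpoly_mul _ l G); last first.
  by rewrite p /psign; move: bb; do 6!case: (odd _).
rewrite -(@Qpoly_mul _ l G); last first.
  by rewrite p !psign_add //; do 4!case: (odd _).
rewrite QpolyE (flowpoly_glued2 l gl ab) !flowpoly_add //.
move: ((-1) ^+ _)%R (flowpoly _ l) (flowpoly _ l) (gpflow _ _ _ _) (gpflow _ _ _ _).
by move=> s x y p1 p2; ring.
Qed.

(** Replacing F(G1) by F(G1/ab) creates the excess (l-1) P_G1 F(G2). Subtracting F(G1+ab) F(G2+2ab)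
    removes it, and the coefficients of P_G1 P_G2 combine through (l-1) - (l-2) = 1. The subtracted
    product involves three added edges, so its sign is reversed and it enters positively. The vertex
    lost in G1/ab is why the block numbers must have an odd sum. *)
Lemma Qpoly_glued2_identify (R : realType) (l : R) G G1 G2 a b : nonseparable G ->
  glued G G1 G2 [fset a; b] -> a != b -> gE G1 != fset0 ->
  nonseparable (add_edge G1 a b) -> nonseparable (add_edge G2 a b) ->
  nonseparable (add2_edge G2 a b) ->
  odd (nblocks (identify G1 a b) + nblocks G2) ->
  ((l - 1) * Qpoly G l = (l - 1) * (Qpoly (identify G1 a b) l * Qpoly G2 l) +
     (l - 1) * (Qpoly (add_edge G1 a b) l * Qpoly (add_edge G2 a b) l) +
     Qpoly (add_edge G1 a b) l * Qpoly (add2_edge G2 a b) l)%R.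
Proof.
move=> nG gl ab E1 n1 n2 n22; rewrite oddD => bb; have [s1 s2 VI _ [_ EU]] := gl.
have [w1 _ _ _] := s1; have [w2 _ _ _] := s2.
have E0 : gE G != fset0 by rewrite -EU fsetU_eq0 (negbTE E1).
have [[a1 a2] [b1 b2]] : (a \in gV G1 /\ a \in gV G2) /\ (b \in gV G1 /\ b \in gV G2).
  by split; [move/fsetP/(_ a): VI|move/fsetP/(_ b): VI];
    rewrite !inE eqxx ?orbT => /andP[].
have p : psign G = odd #|` gE G1| (+) odd #|` gE G2| (+) (odd #|` gV G1| (+) odd #|` gV G2|).
  by rewrite psign_nonseparable // !(odd_glued gl) cardfs2 ab /= addbF.
rewrite -(@Qpoly_mul _ l G); last first.
  rewrite p /psign; have := cardfsD1 b (gV G1); rewrite b1 => ->.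
  by move: bb; rewrite /= (negbTE ab) oddD /=; do 6!case: (odd _).
rewrite -(@Qpoly_mul _ l G); last first.
  by rewrite p !psign_add //; do 4!case: (odd _).
have -> : (Qpoly (add_edge G1 a b) l * Qpoly (add2_edge G2 a b) l =
    - ((-1) ^+ psign G * (flowpoly (add_edge G1 a b) l * flowpoly (add2_edge G2 a b) l)))%R.
  rewrite (@Qpoly_mulN _ l G) ?opprK // p !psign_add // card_E_add /=.
  by do 4!case: (odd _).
rewrite QpolyE (flowpoly_glued2 l gl ab) flowpoly_add2 // !flowpoly_add //.
rewrite flowpoly_identify //.
move: ((-1) ^+ _)%R (flowpoly _ l) (flowpoly _ l) (gpflow _ _ _ _) (gpflow _ _ _ _).
by move=> s x y p1 p2; ring.
Qed.

(** * Induction on the number of edges *)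

Theorem theorem3p2 (R : realType) (S S' : graph -> Prop) (beta : R) :
  (forall G, S G -> connected G /\ bridgeless G) ->
  (1 < beta)%R -> (beta <= 2)%R ->
  (forall G, S' G -> S G) ->
  (* (i) *)
  (forall G, S' G -> forall l : R, (1 < l)%R -> (l < beta)%R -> (0 < Qpoly G l)%R) ->
  (* (ii) *)
  (forall G, S G -> separable G -> forall B, is_block G B -> S B) ->
  (* (iii) *)
  (forall G, S G -> ~ S' G -> nonseparable G ->
     (* (a) *)
     (exists e u1 u2 v, exists H1 H2,
        [/\ e \in gE G, (gends G e = (u1, u2) \/ gends G e = (u2, u1)),
            is_cut_vertex (del_edge G e) v &
            subgraph H1 (del_edge G e) /\ subgraph H2 (del_edge G e)] /\
        [/\ gE H1 `&` gE H2 = fset0, gE H1 `|` gE H2 = gE (del_edge G e),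
            gV H1 `&` gV H2 = [fset v], gV H1 `|` gV H2 = gV G &
        [/\ u1 \in gV H1, u2 \in gV H2,
            S (add_edge H1 v u1) & S (add_edge H2 v u2)]])
     \/
     (* (b) *)
     (exists e, [/\ e \in gE G, S (del_edge G e), S (contract G e),
                    odd (nblocks (del_edge G e)) & odd (nblocks (contract G e))])
     \/
     (* (c) *)
     (exists G1 G2 u1 u2,
        [/\ subgraph G1 G, subgraph G2 G,
            gV G1 `&` gV G2 = [fset u1; u2], gV G1 `|` gV G2 = gV G &
        [/\ gE G1 `&` gE G2 = fset0, gE G1 `|` gE G2 = gE G,
            ~~ odd (nblocks G1 + nblocks G2),
            (2 <= #|` gE G1|)%N & (2 <= #|` gE G2|)%N] /\
        [/\ S G1, S (add_edge G1 u1 u2), S G2 & S (add_edge G2 u1 u2)]])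
     \/
     (* (d) *)
     (exists G1 G2 u1 u2,
        [/\ subgraph G1 G, subgraph G2 G,
            (3 <= #|` gE G1|)%N, (2 <= #|` gE G2|)%N &
        [/\ gV G1 `&` gV G2 = [fset u1; u2], gV G1 `|` gV G2 = gV G,
            gE G1 `&` gE G2 = fset0, gE G1 `|` gE G2 = gE G &
            odd (nblocks (identify G1 u1 u2) + nblocks G2)] /\
        [/\ S (add_edge G1 u1 u2), S (identify G1 u1 u2), S G2,
            S (add_edge G2 u1 u2) & S (add2_edge G2 u1 u2)]])) ->
  forall G, S G -> forall l : R, (1 < l)%R -> (l < beta)%R -> (0 < Qpoly G l)%R.
Proof.
move=> Scb b1 b2 S'S i ii iii G SG l l1 lb.
elim/ltn_ind: {G}#|` gE G| {-2}G (erefl #|` gE G|) SG => n IHn G En SG.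
have IH H : S H -> (#|` gE H| < #|` gE G|)%N -> (0 < Qpoly H l)%R.
  by move=> SH lt; apply: (IHn #|` gE H|); rewrite -?En.
have l0 : (0 < l - 1)%R by rewrite subr_gt0.
have [cG _] := Scb G SG.
have [nG|sG] := pselect (nonseparable G); last first.
  apply: Qpoly_blocks_gt0 => // B bB B0; apply: IH (block_card_E cG sG bB B0).
  exact: ii G SG (conj cG sG) B bB.
have [S'G|nS'] := pselect (S' G); first exact: i.
have conn H : S H -> connected H by move=> /Scb[].
have E0 (H : graph) k : (k.+1 <= #|` gE H|)%N -> gE H != fset0.
  by rewrite -cardfs_gt0; apply: leq_ltn_trans.
(* The identities for (a), (c) and (d) give (l-1) Q(G), so positivity is proved for that product. *)
rewrite -(pmulr_rgt0 _ l0).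
case: (iii G SG nS' nG) => [|[|[|]]].
- move=> [e [u1 [u2 [v [H1 [H2 [[eE ee cut [s1 s2]] [EI EU VI VU [u1V u2V SH1 SH2]]]]]]]]].
  have gl : glued (del_edge G e) H1 H2 [fset v] by split.
  have [n1 n2] : u1 != v /\ u2 != v.
    by have [] := cut_del_end nG cut; case: ee => -> /=.
  have ee' : gends G e = (u2, u1) \/ gends G e = (u1, u2) by case: ee; [right|left].
  have m1 := bridge_side_neq0 nG gl ee u1V u2V n1 n2.
  have m2 := bridge_side_neq0 nG (gluedC gl) ee' u2V u1V n2 n1.
  rewrite (Qpoly_bridge l nG eE ee gl u1V u2V).
  + have cE : #|` gE G| = (#|` gE H1| + #|` gE H2|).+1.
      by rewrite (cardfsD1 e) eE add1n -(card_disjointU EI) EU.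
    move: m1 m2; rewrite -!cardfs_gt0 => m1 m2.
    apply: mulr_gt0; apply: IH => //; rewrite card_E_add cE ltnS.
      by rewrite -addn1 leq_add2l.
    by rewrite -add1n leq_add2r.
  + exact: nonseparable_add_bridge nG gl eE ee u1V u2V n1 (conn _ SH1).
  + exact: nonseparable_add_bridge nG (gluedC gl) eE ee' u2V u1V n2 (conn _ SH2).
- move=> [e [eE Sd Sc od oc]]; rewrite (Qpoly_delete_contract l nG eE od oc).
  have lt : (#|` gE G `\ e| < #|` gE G|)%N by rewrite (cardfsD1 e (gE G)) eE.
  by rewrite mulr_gt0 // addr_gt0 //; apply: IH.
- move=> [G1 [G2 [u1 [u2 [s1 s2 VI VU [[EI EU bb c1 c2] [S1 S1' S2 S2']]]]]]].
  have gl : glued G G1 G2 [fset u1; u2] by split.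
  have m1 := E0 _ _ c1; have m2 := E0 _ _ c2.
  have u12 := glued2_neq nG gl m1 m2.
  have n1 := nonseparable_add nG gl u12 (conn _ S1').
  have n2 := nonseparable_add nG (gluedC gl) u12 (conn _ S2').
  rewrite (Qpoly_glued2 l nG gl u12 m1 n1 n2 bb).
  have cE : #|` gE G| = (#|` gE G1| + #|` gE G2|)%N by rewrite -EU card_disjointU.
  have q1 : (0 < Qpoly G1 l)%R.
    by apply: IH => //; rewrite cE -[X in (X < _)%N]addn0 ltn_add2l ltnW.
  have q2 : (0 < Qpoly G2 l)%R.
    by apply: IH => //; rewrite cE -[X in (X < _)%N]add0n ltn_add2r ltnW.
  (* The added edge is outweighed by the two edges of the other side. *)
  have q1' : (0 < Qpoly (add_edge G1 u1 u2) l)%R.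
    by apply: IH => //; rewrite card_E_add cE -addn1 ltn_add2l.
  have q2' : (0 < Qpoly (add_edge G2 u1 u2) l)%R.
    by apply: IH => //; rewrite card_E_add cE -[X in (X < _)%N]add1n ltn_add2r.
  by apply: addr_gt0; do 2?[assumption | apply: mulr_gt0].
- move=> [G1 [G2 [u1 [u2 [s1 s2 c1 c2 [[VI VU EI EU bb] [S1' S1i S2 S2' S2'']]]]]]].
  have gl : glued G G1 G2 [fset u1; u2] by split.
  have m1 := E0 _ _ c1; have m2 := E0 _ _ c2.
  have u12 := glued2_neq nG gl m1 m2.
  have n1 := nonseparable_add nG gl u12 (conn _ S1').
  have n2 := nonseparable_add nG (gluedC gl) u12 (conn _ S2').
  have [u1V u2V] : u1 \in gV G2 /\ u2 \in gV G2.
    by split; [move/fsetP/(_ u1): VI|move/fsetP/(_ u2): VI];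
      rewrite !inE eqxx ?orbT => /andP[].
  have n3 := nonseparable_parallel n2 u1V u2V u12.
  rewrite (Qpoly_glued2_identify l nG gl u12 m1 n1 n2 n3 bb).
  have cE : #|` gE G| = (#|` gE G1| + #|` gE G2|)%N by rewrite -EU card_disjointU.
  have q1 : (0 < Qpoly (identify G1 u1 u2) l)%R.
    by apply: IH => //=; rewrite cE -[X in (X < _)%N]addn0 ltn_add2l ltnW.
  have q2 : (0 < Qpoly G2 l)%R.
    by apply: IH => //; rewrite cE -[X in (X < _)%N]add0n ltn_add2r (ltn_trans _ c1).
  have q1' : (0 < Qpoly (add_edge G1 u1 u2) l)%R.
    by apply: IH => //; rewrite card_E_add cE -addn1 ltn_add2l.
  have q2' : (0 < Qpoly (add_edge G2 u1 u2) l)%R.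
    by apply: IH => //; rewrite card_E_add cE -[X in (X < _)%N]add1n ltn_add2r ltnW.
  (* Two added edges call for the three edges of [G1]. *)
  have q2'' : (0 < Qpoly (add2_edge G2 u1 u2) l)%R.
    by apply: IH => //; rewrite /add2_edge !card_E_add cE -[X in (X < _)%N]add2n ltn_add2r.
  by apply: addr_gt0; [apply: addr_gt0|]; do 2?[assumption | apply: mulr_gt0].
Qed.
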